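(* Let $G=F_2\times F_2$, where the first factor is free on $x,y$ and the second factor is free on $c,t$. Let $S_1=\{x,y,c,t\}$ and $S_2=\{a,b,c,t\}$, where $a=xc^{-1}$ and $b=yc^{-1}$; both are generating sets of $G$. (i) Let $K$ be any property of pairs (group, finite generating set) such that every pair satisfying the falsification by fellow traveler property (FFTP) satisfies $K$, and every pair satisfying $K$ satisfies minimal almost convexity (MAC). Then $(G,S_1)$ satisfies $K$ and $(G,S_2)$ does not satisfy $K$; hence $K$ depends on the generating set. In particular, each of the following properties depends on the generating set: FFTP, the basepoint loop shortening property (BLSP), almost convexity (AC), Poénaru's condition $P(2)$, M$'$AC and MAC. (ii) The loop shortening property (LSP) also depends on the generating set: $(G,S_1)$ satisfies LSP and $(G,S_2)$ does not.
   Context: A property of pairs $(G,S)$, with $G$ a group and $S$ a finite generating set of $G$, depends on the generating set if there are a group $G$ and finite generating sets $S,S'$ of $G$ such that $(G,S)$ has the property and $(G,S')$ does not. The Cayley graph $\Gamma=\Gamma(G,S)$ has vertex set $G$ and an edge joining $g$ and $gs$ for each $g\in G$, $s\in S$. Regard $\Gamma$ as a metric space $\tilde\Gamma$ in which each edge is a segment of length $1$, and let $d$ be the path metric; thus $d(g_1,g_2)$, for $g_1,g_2\in G$, is the length of a shortest word over $S\cup S^{-1}$ representing $g_1^{-1}g_2$. Write $|z|=d(1,z)$, $Sph(r)=\{z\in\tilde\Gamma:|z|=r\}$ and $\overline{B(r)}=\{z\in\tilde\Gamma:|z|\leq r\}$. Paths between vertices are taken to be sequences of joined edges, with length the number of edges.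 FFTP: there is a constant $k$ such that for every word $w$ over $S\cup S^{-1}$ which is not geodesic (i.e. not of minimal length among words representing the same element), there is a shorter word $u$ representing the same element such that, writing $w(j)$ and $u(j)$ for the elements represented by the prefixes of length $j$ of $w$ and $u$ (and by the whole word if $j$ exceeds its length), $d(w(j),u(j))\leq k$ for all $j\geq 0$. A loop is a sequence of vertices $v_0,\ldots,v_n$ with $v_n=v_0$ in which each vertex is adjacent to the previous one; its length is $n$. LSP: there is a constant $k$ such that for any loop $v_0,\ldots,v_n$ in $\Gamma(G,S)$ with $n\geq1$ there is a shorter loop $u_0,\ldots,u_m$ ($m<n$, $u_m=u_0$) such that $d(u_j,v_j)<k$ for each $0\leq j\leq m$ and $d(u_m,v_j)<k$ for $m\leq j\leq n$. BLSP: the same as LSP, but with the additional requirement $u_0=v_0$. For $r_0$ a positive integer and $f:\mathbb{N}\to\mathbb{N}$, the pair $(G,S)$ satisfies $\mathrm{AC}_{f,r_0}$ if: whenever $r\in\mathbb{Z}$ satisfies $r>r_0$ and $u,v\in Sph(r)$ satisfy $d(u,v)\leq2$, there is a path between $u$ and $v$ contained in $\overline{B(r)}$ of length at most $f(r)$. The pair satisfies: - AC if it satisfies $\mathrm{AC}_{f,r_0}$ for some constant function $f$ and some $r_0>0$; - $P(2)$ if it satisfies $\mathrm{AC}_{f,r_0}$ for some sub-linear function $f$ (i.e. $f(r)/r\to0$ as $r\to\infty$) and some $r_0>0$; - MAC if it satisfies $\mathrm{AC}_{f,r_0}$ for some $r_0>0$ with $f(x)=2x-1$; - M$'$AC if it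 satisfies $\mathrm{AC}_{f,r_0}$ for some $r_0>0$ with $f(x)=2x-2$. *)

(* Defs.v *)
From HB Require Import structures.
From mathcomp Require Import all_boot all_order all_algebra finmap.
From mathcomp Require Import boolp classical_sets reals topology normedtype.

Set Implicit Arguments.
Unset Strict Implicit.
Unset Printing Implicit Defensive.

Import Order.TTheory GRing.Theory Num.Theory.
Import numFieldNormedType.Exports.

Local Open Scope group_scope.

(** * Free groups

    A letter [(x, false)] stands for the generator [x], and [(x, true)] for its
    inverse; group elements are the reduced words. *)

Section FreeGroup.
Variable X : choiceType.

Definition letter := (X * bool)%type.
Implicit Types (a b : letter) (w u v : seq letter).

Definition letter_inv a : letter := (a.1, ~~ a.2).

Definition reduced w : bool :=
  if w is a :: w' then path (fun a b => b != letter_inv a) a w' else true.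

Definition push a w : seq letter :=
  if w is b :: w' then if b == letter_inv a then w' else a :: w else [:: a].

Definition reduce w : seq letter := foldr push [::] w.

Lemma letter_invK : involutive letter_inv.
Proof. by case=> x b; rewrite /letter_inv /= negbK. Qed.

Lemma reduced_tail a w : reduced (a :: w) -> reduced w.
Proof. by case: w => //= b w /andP[]. Qed.

Lemma push_reduced a w : reduced w -> reduced (push a w).
Proof.
case: w => //= b w; case: eqP => [_|/eqP nba] rw; last by rewrite /= nba.
exact: (@reduced_tail b).
Qed.

Lemma reduce_reduced w : reduced (reduce w).
Proof. by elim: w => //= a w; exact: push_reduced. Qed.

Lemma reduced_reduce w : reduced w -> reduce w = w.
Proof.
elim: w => //= a w IHw raw; rewrite IHw; last exact: (@reduced_tail a).
by case: w raw {IHw} => //= b w /andP[/negPf ->].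
Qed.

Lemma pushK a w : reduced w -> push (letter_inv a) (push a w) = w.
Proof.
case: w => [|b w] /=; first by rewrite letter_invK eqxx.
case: eqP => [-> |_ _]; last by rewrite /= letter_invK eqxx.
by case: w => //= c w /andP[/negPf ->].
Qed.

Lemma foldr_push_reduced u w : reduced w -> reduced (foldr push w u).
Proof. by elim: u => //= a u IHu rw; apply/push_reduced/IHu. Qed.

Lemma foldr_push_push a u w : reduced w ->
  foldr push w (push a u) = push a (foldr push w u).
Proof.
case: u => //= b u rw; case: eqP => // ->.
by have := pushK (letter_inv a) (foldr_push_reduced u rw); rewrite letter_invK.
Qed.

Lemma foldr_push_reduce u w : reduced w ->
  foldr push w (reduce u) = foldr push w u.
Proof. by elim: u => //= a u IHu rw; rewrite foldr_push_push // IHu. Qed.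

Lemma reduce_cat u v : reduce (u ++ v) = foldr push (reduce v) u.
Proof. exact: foldr_cat. Qed.

Lemma reduce_catl u v : reduce (reduce u ++ v) = reduce (u ++ v).
Proof. by rewrite !reduce_cat foldr_push_reduce // reduce_reduced. Qed.

Lemma reduce_catr u v : reduce (u ++ reduce v) = reduce (u ++ v).
Proof. by rewrite !reduce_cat (reduced_reduce (reduce_reduced v)). Qed.

Definition word_inv w : seq letter := rev (map letter_inv w).

Lemma reduce_invl w : reduce (word_inv w ++ w) = [::].
Proof.
elim: w => //= a w IHw; rewrite /word_inv /= rev_cons cat_rcons reduce_cat /=.
by rewrite pushK ?reduce_reduced // -reduce_cat.
Qed.

Lemma word_invK : involutive word_inv.
Proof.
by move=> w; rewrite /word_inv map_rev revK -map_comp map_id_in // => a _;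
  exact: letter_invK.
Qed.

Lemma reduce_invr w : reduce (w ++ word_inv w) = [::].
Proof. by rewrite -{1}(word_invK w) reduce_invl. Qed.

Record freeGroup := FreeGroup { fg_word :> seq letter; _ : reduced fg_word }.

HB.instance Definition _ := [isSub for fg_word].
HB.instance Definition _ := [Choice of freeGroup by <:].

Definition fg_of w : freeGroup := FreeGroup (reduce_reduced w).
Definition fg_one : freeGroup := fg_of [::].
Definition fg_mul (g h : freeGroup) : freeGroup :=
  fg_of (fg_word g ++ fg_word h).
Definition fg_inv (g : freeGroup) : freeGroup := fg_of (word_inv g).

Lemma fg_mulA : associative fg_mul.
Proof.
by move=> f g h; apply: val_inj; rewrite /= reduce_catr reduce_catl catA.
Qed.

Lemma fg_mul1 : left_id fg_one fg_mul.
Proof. by case=> w rw; apply: val_inj; rewrite /= reduced_reduce. Qed.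

Lemma fg_1mul : right_id fg_one fg_mul.
Proof. by case=> w rw; apply: val_inj; rewrite /= cats0 reduced_reduce. Qed.

Lemma fg_mulV : left_inverse fg_one fg_inv fg_mul.
Proof. by move=> g; apply: val_inj; rewrite /= reduce_catl reduce_invl. Qed.

Lemma fg_Vmul : right_inverse fg_one fg_inv fg_mul.
Proof. by move=> g; apply: val_inj; rewrite /= reduce_catr reduce_invr. Qed.

HB.instance Definition _ :=
  isGroup.Build freeGroup fg_mulA fg_mul1 fg_1mul fg_mulV fg_Vmul.

Definition fg_gen (x : X) : freeGroup := fg_of [:: (x, false)].

(* The universal property of [freeGroup] and [fg_gen]. *)

Definition eval_letter (H : groupType) (f : X -> H) (a : letter) : H :=
  if a.2 then (f a.1)^-1 else f a.1.

Lemma eval_letter_inv (H : groupType) (f : X -> H) a :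
  eval_letter f (letter_inv a) = (eval_letter f a)^-1.
Proof. by case: a => x [] //=; rewrite /eval_letter /= invgK. Qed.

Lemma eval_reduce (H : groupType) (f : X -> H) w :
  \prod_(a <- reduce w) eval_letter f a = \prod_(a <- w) eval_letter f a.
Proof.
elim: w => //= a w IHw; rewrite big_cons -IHw /push.
case: (reduce w) => [|b v]; first by rewrite big_cons.
case: eqP => [->|_]; last by rewrite big_cons.
by rewrite big_cons eval_letter_inv mulgA mulgV mul1g.
Qed.

Lemma freeGroup_lift (H : groupType) (f : X -> H) :
  exists phi : freeGroup -> H,
    {morph phi : g h / g * h} /\ (forall x, phi (fg_gen x) = f x).
Proof.
exists (fun g => \prod_(a <- fg_word g) eval_letter f a); split.
  by move=> g h; rewrite /= eval_reduce big_cat.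
by move=> x; rewrite big_cons big_nil mulg1.
Qed.

Lemma freeGroup_lift_uniq (H : groupType) (phi psi : freeGroup -> H) :
  {morph phi : g h / g * h} -> {morph psi : g h / g * h} ->
  (forall x, phi (fg_gen x) = psi (fg_gen x)) -> phi =1 psi.
Proof.
move=> phiM psiM eq_gen.
have morph1 (f : freeGroup -> H) : {morph f : g h / g * h} -> f 1 = 1.
  by move=> fM; apply: (mulgI (f 1)); rewrite -fM !mulg1.
have eq_letter a : phi (fg_of [:: a]) = psi (fg_of [:: a]).
  case: a => x [|]; last exact: eq_gen.
  have E : fg_of [:: (x, true)] * fg_gen x = 1.
    by apply: val_inj; rewrite /= /letter_inv /= eqxx.
  by apply: (mulIg (phi (fg_gen x))); rewrite -phiM eq_gen -psiM E !morph1.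
case=> w; elim: w => [|a w IHw] rw.
  have -> : FreeGroup rw = 1 by apply: val_inj.
  by rewrite !morph1.
have -> : FreeGroup rw = fg_of [:: a] * FreeGroup (reduced_tail rw).
  apply: val_inj => /=; rewrite (reduced_reduce (reduced_tail rw)).
  by case: w rw {IHw} => //= b w /andP[/negPf ->].
by rewrite phiM psiM eq_letter IHw.
Qed.

End FreeGroup.

(** * Words, generating sets, Cayley graphs *)

Section Cayley.
Variable G : groupType.
Variable S : {fset G}.
Implicit Types (g h : G) (w : seq G).

Definition sym_gens : {fset G} := (S `|` [fset s^-1 | s in S])%fset.

Definition is_word w : Prop := {subset w <= sym_gens}.

Definition word_val w : G := \prod_(s <- w) s.

Definition generates : Prop := forall g, exists w, is_word w /\ word_val w = g.

Definition word_dist_spec g h (n : nat) : Prop :=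
  exists w, [/\ is_word w, word_val w = g^-1 * h & size w = n].

(* The value 0 for a pair joined by no word never occurs when [S] generates. *)
Definition dist g h : nat :=
  if pselect (exists n, `[< word_dist_spec g h n >]) is left E
  then ex_minn E else 0.

Definition geodesic w : Prop :=
  forall w', is_word w' -> word_val w' = word_val w -> size w <= size w'.

(* The edge [(g, s)] joins [g] and [g * s]; when [s] and [s^-1] both lie in [S],
   the edges [(g, s)] and [(g * s, s^-1)] are parallel. *)
Definition edge := (G * S)%type.
Definition src (e : edge) : G := e.1.
Definition tgt (e : edge) : G := e.1 * fsval e.2.

Definition joins (e : edge) g h : Prop :=
  (g = src e /\ h = tgt e) \/ (g = tgt e /\ h = src e).

Definition adj_vertices g h : Prop := exists e, joins e g h.

(* A sequence of [n.+1] vertices is a function on [nat] whose values beyond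
   [n] are ignored. *)
Definition loop (n : nat) (v : nat -> G) : Prop :=
  v n = v 0 /\ forall i, i < n -> adj_vertices (v i) (v i.+1).

Fixpoint edge_path (u : G) (p : seq edge) (v : G) : Prop :=
  if p is e :: p' then exists2 u', joins e u u' & edge_path u' p' v else u = v.

(** * Falsification by fellow traveler, loop shortening *)

Definition FFTP : Prop :=
  exists k : nat, forall w, is_word w -> ~ geodesic w ->
    exists u : seq G,
      [/\ is_word u, size u < size w, word_val u = word_val w &
        forall j, dist (word_val (take j w)) (word_val (take j u)) <= k].

Definition shortens (k n : nat) (v : nat -> G) (m : nat) (u : nat -> G) : Prop :=
  [/\ m < n, loop m u,
      forall j, j <= m -> dist (u j) (v j) < k &
      forall j, m <= j <= n -> dist (u m) (v j) < k].

Definition LSP : Prop :=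
  exists k : nat, forall n (v : nat -> G), 1 <= n -> loop n v ->
    exists m (u : nat -> G), shortens k n v m u.

Definition BLSP : Prop :=
  exists k : nat, forall n (v : nat -> G), 1 <= n -> loop n v ->
    exists m (u : nat -> G), shortens k n v m u /\ u 0 = v 0.

End Cayley.

(** * The geometric realization and the almost convexity conditions *)

Section Realization.
Variable R : realType.
Variable G : groupType.
Variable S : {fset G}.

(* [Inner e t] is the point of the open edge [e] at distance [t] from [src e]
   along [e]. *)
Inductive rpoint : Type :=
| Vertex of G
| Inner of edge S & {t : R | (0 < t < 1)%R}.

Local Open Scope ring_scope.

Definition dist_to_vertex (z : rpoint) (h : G) : R :=
  match z with
  | Vertex g => (dist S g h)%:R
  | Inner e t => Num.min (sval t + (dist S (src e) h)%:R)
                         (1 - sval t + (dist S (tgt e) h)%:R)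
  end.

(* The path metric: a shortest path to an interior point of an edge enters that
   edge through one of its two ends, unless it stays inside the edge. *)
Definition pdist (z z' : rpoint) : R :=
  match z' with
  | Vertex h => dist_to_vertex z h
  | Inner e' t' =>
      let via_ends := Num.min (dist_to_vertex z (src e') + sval t')
                              (dist_to_vertex z (tgt e') + (1 - sval t')) in
      match z with
      | Vertex _ => via_ends
      | Inner e t =>
          if e == e' then Num.min `|sval t - sval t'| via_ends else via_ends
      end
  end.

Definition norm (z : rpoint) : R := pdist (Vertex 1%g) z.

Definition Sph (r : nat) : set rpoint := [set z | norm z = r%:R].

Definition cball (r : nat) : set rpoint := [set z | norm z <= r%:R].

Definition closed_edge (e : edge S) : set rpoint :=
  [set z | z = Vertex (src e) \/ z = Vertex (tgt e) \/ exists t, z = Inner e t].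

Definition path_support (u : G) (p : seq (edge S)) : set rpoint :=
  [set z | z = Vertex u \/ exists2 e, e \in p & closed_edge e z].

Definition path_between (z z' : rpoint) (p : seq (edge S)) (A : set rpoint) : Prop :=
  exists u v, [/\ z = Vertex u, z' = Vertex v, edge_path u p v &
                  (path_support u p `<=` A)%classic].

Definition AC_f (f : nat -> nat) (r0 : nat) : Prop :=
  forall r : nat, (r0 < r)%N -> forall z z' : rpoint,
    Sph r z -> Sph r z' -> pdist z z' <= 2 ->
    exists p, path_between z z' p (cball r) /\ (size p <= f r)%N.

Definition sublinear (f : nat -> nat) : Prop :=
  ((fun n => (f n)%:R / n%:R : R) @ \oo --> (0 : R))%classic.

Definition AlmostConvex : Prop :=
  exists (c : nat) (r0 : nat), (0 < r0)%N /\ AC_f (fun _ => c) r0.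

Definition PoenaruP2 : Prop :=
  exists (f : nat -> nat) (r0 : nat),
    [/\ sublinear f, (0 < r0)%N & AC_f f r0].

Definition MAC : Prop :=
  exists r0 : nat, (0 < r0)%N /\ AC_f (fun x => (2 * x - 1)%N) r0.

Definition MprimeAC : Prop :=
  exists r0 : nat, (0 < r0)%N /\ AC_f (fun x => (2 * x - 2)%N) r0.

End Realization.

(** * Dependence on the generating set *)

(* Only the values at generating sets matter: it is always used together with
   [generates]. *)
Definition pair_property := forall G : groupType, {fset G} -> Prop.

Definition depends_on_generating_set (K : pair_property) : Prop :=
  exists (G : groupType) (S S' : {fset G}),
    [/\ generates S, generates S', K G S & ~ K G S'].

(** * The group [F_2 x F_2] and its two generating sets *)

Definition F2 : groupType := freeGroup bool.
Definition F2xF2 : groupType := (F2 * F2)%type.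

Definition gen_x : F2xF2 := (fg_gen false, 1).
Definition gen_y : F2xF2 := (fg_gen true, 1).
Definition gen_c : F2xF2 := (1, fg_gen false).
Definition gen_t : F2xF2 := (1, fg_gen true).
Definition gen_a : F2xF2 := gen_x * gen_c^-1.
Definition gen_b : F2xF2 := gen_y * gen_c^-1.

Definition S1 : {fset F2xF2} := [fset gen_x; gen_y; gen_c; gen_t]%fset.
Definition S2 : {fset F2xF2} := [fset gen_a; gen_b; gen_c; gen_t]%fset.

(* Main.v *)
Require Import Defs.
From mathcomp Require Import all_boot all_order all_algebra finmap.
From mathcomp Require Import boolp classical_sets reals topology normedtype.
From mathcomp Require Import sequences zify lra.

(** The group is a product of two free groups, and the two halves of the claim
    rest on how each generating set sees that product.

    For [S1] the word length is the sum of the two free-group lengths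
    ([dist_S1]).  A word that is not geodesic therefore has a factor
    [s q s^-1] with [q] written in the other free factor, so [q] commutes with
    [s]; deleting [s] and [s^-1] shortens the word while the prefixes stay at
    distance at most two ([FFTP_S1]).  The same length formula gives almost
    convexity with constant two ([AC_S1]): if [g s m] is on the sphere of [g]
    and [g s] lies outside it, then either [m = s^-1] or [s] and [m] commute
    and [g m] lies inside.

    For [S2] the generators are the slanted letters [(x, c^-1)], [(y, c^-1)] and
    the letters [(1, c)], [(1, t)].  Word length is explicit in the quotient where
    [c] and [t] commute, and this yields the lower bound [norm2_le_dist]:
    reaching [(g, 1)] costs at least the length of [g] plus the absolute value of
    its exponent sum, which is twice the larger of the numbers of positive and of
    negative letters of [g].  On the other hand the points [low w], which are
    the values of the words in the slanted letters, are at distance at most the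
    length of [w].  The elements whose second coordinate starts with [t] form
    one side of a wall: the tree structure of the second factor forces every
    path that changes sides to cross an edge from [(g, 1)] to [(g, t)]
    ([crossing_down]), and the location of [g] is constrained.

    - Minimal almost convexity fails ([not_MAC_S2]): take [w = y^-n x^n], whose
      exponent sum vanishes, so that [low w = (w, 1)] has norm [2n], and the
      point [up] of [y^-n x^(n-1)], also of norm [2n], at distance two across
      the wall.  A path in the ball must cross at a [g] with fewer than [n]
      negative letters; such a [g] is at distance at least [2n] from [w], so the
      path has length at least [4n].

    - Loop shortening fails ([not_LSP_S2]): the loop spelling the commutation of
      [t] with [w = x^n y^(-2n) x^n] has length [8n + 2].  A nearby shorter loop
      still crosses the wall once near [w] and once near [1], and any two such
      crossing points differ by an element with at least [2n] negative letters,
      so each of the two arcs in between has length at least [4n].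

    The remaining conditions are linked by the implications
    FFTP => BLSP => LSP ([FFTP_BLSP], [BLSP_LSP]) and
    AC => P(2) => M'AC => MAC ([AC_P2], [P2_MprimeAC], [MprimeAC_MAC]). *)

Set Implicit Arguments.
Unset Strict Implicit.
Unset Printing Implicit Defensive.

Import Order.TTheory GRing.Theory Num.Theory.
Import numFieldNormedType.Exports.

Local Open Scope group_scope.

(** * Reduced words and lengths in free groups *)

Section Words.
Variable X : choiceType.
Implicit Types (a b : letter X) (u v w : seq (letter X)) (g h : freeGroup X).

Lemma size_push a w :
  size (push a w) = (size w).+1 \/ size w = (size (push a w)).+1.
Proof. by case: w => [|b w] /=; [left | case: ifP; [right | left]]. Qed.

Lemma size_reduce w : size (reduce w) <= size w.
Proof. by elim: w => //= a w IH; have := size_push a (reduce w); lia. Qed.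

Lemma odd_size_reduce w : odd (size (reduce w)) = odd (size w).
Proof.
elim: w => //= a w IH; rewrite -IH.
by case: (size_push a (reduce w)) => [->|->] //=; rewrite negbK.
Qed.

Lemma reduced_size w : size (reduce w) = size w -> reduced w.
Proof.
elim: w => //= a w IH Ea.
have rw : reduced w.
  by apply: IH; have := size_push a (reduce w); have := size_reduce w; lia.
move: Ea; rewrite reduced_reduce //; case: w rw {IH} => //= b w rw.
by case: eqP => _ /= E; [lia | exact: rw].
Qed.

Lemma mem_reduce w : {subset reduce w <= w}.
Proof.
elim: w => //= a w IH b; rewrite /push inE.
case E: (reduce w) => [|c v]; first by rewrite inE => ->.
have sub d : d \in c :: v -> d \in w by rewrite -E; apply: IH.
case: eqP => _; first by move=> bv; rewrite sub ?orbT // inE bv orbT.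
by rewrite inE => /orP[-> // | /sub ->]; rewrite orbT.
Qed.

Lemma fg_of_cat u v : fg_of (u ++ v) = fg_of u * fg_of v.
Proof. by apply: val_inj; rewrite /= reduce_catr reduce_catl. Qed.

Lemma fg_of_word g : fg_of (fg_word g) = g.
Proof. by apply: val_inj; case: g => w rw /=; rewrite reduced_reduce. Qed.

Lemma fg_of_inv w : fg_of (word_inv w) = (fg_of w)^-1.
Proof.
apply: (mulIg (fg_of w)); rewrite mulVg -fg_of_cat; apply: val_inj => /=.
exact: reduce_invl.
Qed.

Lemma word_inv_cons a w : word_inv (a :: w) = rcons (word_inv w) (letter_inv a).
Proof. by rewrite /word_inv /= rev_cons. Qed.

Lemma word_inv_nseq n a : word_inv (nseq n a) = nseq n (letter_inv a).
Proof. by rewrite /word_inv map_nseq rev_nseq. Qed.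

Lemma reduced_cat_cons u a v :
  reduced (u ++ a :: v) = reduced (rcons u a) && reduced (a :: v).
Proof.
case: u => [|b u] /=; first by [].
by rewrite cat_path rcons_path /= andbA.
Qed.

Lemma reduced_word_inv w : reduced w -> reduced (word_inv w).
Proof.
elim: w => // a w IH raw; rewrite word_inv_cons.
have := IH (reduced_tail raw); case: w raw {IH} => // b w.
rewrite word_inv_cons /= => /andP[ba _] rwb; rewrite -cats1 cat_rcons.
by rewrite reduced_cat_cons rwb /= andbT letter_invK eq_sym.
Qed.

(** Cancellation in [g^-1 * h] is exactly the removal of the longest common
    prefix of [g] and [h]: the distance in the Cayley tree is read off from the
    point where the two geodesics from the identity branch. *)
Lemma fg_mulVg_word g h : exists p u v,
  [/\ fg_word g = p ++ u, fg_word h = p ++ v &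
      fg_word (g^-1 * h) = word_inv u ++ v].
Proof.
case: g h => [g rg] [h rh] /=; rewrite reduce_catl.
elim: g h rg rh => [|a g IH] h rg rh.
  by exists [::], [::], h; rewrite /= reduced_reduce.
case: h rh => [|b h] rh.
  exists [::], (a :: g), [::]; split=> //.
  by rewrite cats0 reduced_reduce // reduced_word_inv.
have [E|/eqP nE] := eqVneq a b.
  subst b; have [p [u [v [Eg Eh E]]]]
    := IH h (reduced_tail rg) (reduced_tail rh).
  exists (a :: p), u, v; split; [by rewrite Eg | by rewrite Eh | rewrite -E].
  rewrite word_inv_cons cat_rcons !reduce_cat /=.
  by rewrite pushK ?reduce_reduced.
exists [::], (a :: g), (b :: h); split=> //; rewrite reduced_reduce //.
have := reduced_word_inv rg.
rewrite word_inv_cons cat_rcons reduced_cat_cons => -> /=.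
by move: rh => /= ->; rewrite letter_invK andbT; apply/eqP => E; apply: nE.
Qed.

Lemma size_fg_inv g : size (fg_word g^-1) = size g.
Proof.
case: g => w rw /=; rewrite reduced_reduce ?reduced_word_inv //.
by rewrite /word_inv size_rev size_map.
Qed.

Lemma size_fg_mul g h : size (fg_word (g * h)) <= size g + size h.
Proof. by rewrite -size_cat; apply: size_reduce. Qed.

(** The homomorphism to the integers that sends the generator [x] to [f x]. *)
Definition exponent (f : X -> int) w : int :=
  (\sum_(a <- w) (if a.2 then - f a.1 else f a.1))%R.

Lemma exponent_cat f u v : exponent f (u ++ v) = (exponent f u + exponent f v)%R.
Proof. by rewrite /exponent big_cat. Qed.

Lemma exponent_cons f a w :
  exponent f (a :: w) = ((if a.2 then - f a.1 else f a.1) + exponent f w)%R.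
Proof. by rewrite /exponent big_cons. Qed.

Lemma exponent_reduce f w : exponent f (reduce w) = exponent f w.
Proof.
elim: w => //= a w IH; rewrite exponent_cons -IH.
case: (reduce w) => [|b v] /=; first by rewrite exponent_cons.
case: eqP => [->|_]; rewrite !exponent_cons //=.
by rewrite addrA -[LHS]add0r; congr (_ + _)%R; case: (a.2) => /=; lia.
Qed.

Lemma exponentM f g h : exponent f (g * h) = (exponent f g + exponent f h)%R.
Proof. by rewrite /= exponent_reduce exponent_cat. Qed.

Lemma exponent_nseq f n a :
  exponent f (nseq n a) = (n%:Z * (if a.2 then - f a.1 else f a.1))%R.
Proof.
elim: n => [|n IH]; first by rewrite /exponent big_nil mul0r.
by rewrite /= exponent_cons IH intS mulrDl mul1r.
Qed.

Lemma exponentV f g : exponent f g^-1 = (- exponent f g)%R.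
Proof.
apply/eqP; rewrite -addr_eq0 -exponentM mulVg.
by rewrite /exponent big_nil.
Qed.

Lemma exponent_bound f w : (forall x, `|f x|%N <= 1) ->
  `|exponent f w|%N <= size w.
Proof.
move=> f1; elim: w => [|a w IH]; first by rewrite /exponent big_nil.
by rewrite exponent_cons /=; have := f1 a.1; case: (a.2); lia.
Qed.

Definition heights w : int := exponent (fun=> 1%R) w.

(** If [w] has [p] positive and [q] negative letters, the right-hand side is
    [p + q + |p - q|], twice the maximum of [p] and [q]. *)
Lemma count_sign_bound (s : bool) w :
  2 * count (fun a => a.2 == s) w <= size w + `|heights w|%N.
Proof.
suff: (size w
    = count (fun a => a.2 == true) w + count (fun a => a.2 == false) w /\
   heights w = (count (fun a => a.2 == false) w)%:Z
              - (count (fun a => a.2 == true) w)%:Z)%R.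
  by case=> -> ->; case: s; lia.
elim: w => [|a w [IH1 IH2]]; first by rewrite /heights /exponent big_nil.
rewrite /heights exponent_cons /= -/(heights w) IH1 IH2.
by case: (a.2) => /=; split; lia.
Qed.
End Words.

Section MoreWords.
Variable X : choiceType.
Implicit Types (a b : letter X) (u v w : seq (letter X)).

Lemma reduced_cons a w :
  reduced w -> ohead w != Some (letter_inv a) -> reduced (a :: w).
Proof. by case: w => //= b w ->; rewrite andbT. Qed.

Lemma letter_inv_neq a : a != letter_inv a.
Proof. by case: a => x []; rewrite /letter_inv /=; apply/eqP => -[]. Qed.

Lemma reduced_nseq_cat n a w :
  reduced w -> ohead w != Some (letter_inv a) -> reduced (nseq n a ++ w).
Proof.
move=> rw wa; elim: n => //= n IH; apply: reduced_cons => //.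
case: n {IH} => //= n; apply/eqP => -[] /eqP; apply/negP/letter_inv_neq.
Qed.

Lemma reduced_nseq n a : reduced (nseq n a).
Proof. by rewrite -[nseq n a]cats0; apply: reduced_nseq_cat. Qed.
End MoreWords.

Lemma fg_gen_inv (X : choiceType) (x : X) : (fg_gen x)^-1 = fg_of [:: (x, true)].
Proof. by rewrite -fg_of_inv. Qed.

Lemma size_mul_letter (X : choiceType) (g : freeGroup X) a :
  size (fg_word (g * fg_of [:: a])) = (size g).+1 \/
  size g = (size (fg_word (g * fg_of [:: a]))).+1.
Proof.
have le1 (h : freeGroup X) b : size (fg_word (h * fg_of [:: b])) <= (size h).+1.
  by rewrite -addn1; apply: size_fg_mul.
have := le1 g a; have := le1 (g * fg_of [:: a]) (letter_inv a).
rewrite -mulgA -fg_of_cat.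
have -> : fg_of [:: a; letter_inv a] = 1 by apply: val_inj => /=; rewrite eqxx.
rewrite mulg1 /= => h1 h2.
have := odd_size_reduce (g ++ [:: a]); rewrite size_cat oddD addbT; lia.
Qed.

(** In a tree, a step away from the root is followed by another one unless the
    path backtracks. *)
Lemma size_mul_two_letters (X : choiceType) (g : freeGroup X) a b :
  size (fg_word (g * fg_of [:: a])) = (size g).+1 ->
  size (fg_word (g * fg_of [:: a] * fg_of [:: b])) = (size g).+2 \/
  b = letter_inv a.
Proof.
move=> E; have rga : reduced (rcons g a).
  by apply: reduced_size; rewrite size_rcons -E -cats1.
have Ew : fg_word (g * fg_of [:: a]) = rcons g a.
  by rewrite /= cats1 reduced_reduce.
have [->|nb] := eqVneq b (letter_inv a); [by right | left].
have -> : fg_word (g * fg_of [:: a] * fg_of [:: b]) = rcons g a ++ [:: b].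
  rewrite -[LHS]/(reduce (fg_word (g * fg_of [:: a]) ++ [:: b])) Ew.
  rewrite reduced_reduce // cat_rcons.
  by rewrite reduced_cat_cons rga /= nb.
by rewrite size_cat size_rcons addn1.
Qed.

(** * The word metric *)

Lemma in_fset4 (T : choiceType) (a b c d x : T) :
  x \in [fset a; b; c; d]%fset <-> [\/ x = a, x = b, x = c | x = d].
Proof.
rewrite !inE -!orbA; split; first by move=> /or4P[] /eqP; constructor.
by case=> ->; rewrite eqxx ?orbT.
Qed.

Section WordMetric.
Variables (G : groupType) (S : {fset G}).
Implicit Types (g h s : G) (w : seq G) (v : nat -> G).

Lemma sym_gens_gen s : s \in S -> s \in sym_gens S.
Proof. by move=> sS; rewrite inE sS. Qed.

Lemma sym_gens_cases s :
  s \in sym_gens S -> s \in S \/ exists2 r, r \in S & s = r^-1.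
Proof.
by rewrite inE => /orP[|/imfsetP[r /= rS ->]]; [left | right; exists r].
Qed.

Lemma sym_gensV s : s \in sym_gens S -> s^-1 \in sym_gens S.
Proof.
rewrite !inE => /orP[sS | /imfsetP[r /= rS ->]]; last by rewrite invgK rS.
by apply/orP; right; apply/imfsetP; exists s.
Qed.

Lemma is_word_cat w1 w2 : is_word S w1 -> is_word S w2 -> is_word S (w1 ++ w2).
Proof. by move=> h1 h2 s; rewrite mem_cat => /orP[/h1 | /h2]. Qed.

Lemma is_word1 s : s \in sym_gens S -> is_word S [:: s].
Proof. by move=> sS r; rewrite inE => /eqP ->. Qed.

Lemma word_val_cat w1 w2 : word_val (w1 ++ w2) = word_val w1 * word_val w2.
Proof. exact: big_cat. Qed.

Lemma word_val_cons s w : word_val (s :: w) = s * word_val w.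
Proof. exact: big_cons. Qed.

Lemma word_val1 s : word_val [:: s] = s.
Proof. exact: big_seq1. Qed.

Lemma is_word_inv w : is_word S w -> is_word S (rev ([seq s^-1 | s <- w])).
Proof.
by move=> ww s; rewrite mem_rev => /mapP[r /ww rS ->]; apply: sym_gensV.
Qed.

Lemma word_val_inv w : word_val (rev ([seq s^-1 | s <- w])) = (word_val w)^-1.
Proof.
elim: w => [|s w IH] /=; first by rewrite /word_val !big_nil invg1.
by rewrite rev_cons -cats1 word_val_cat word_val1 IH word_val_cons invgM.
Qed.

Lemma dist_le g h w : is_word S w -> g * word_val w = h -> dist S g h <= size w.
Proof.
move=> ww <-; have W : word_dist_spec S g (g * word_val w) (size w).
  by exists w; rewrite mulKg.
rewrite /dist; case: pselect => [E|[]]; last by exists (size w); apply/asboolP.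
by case: ex_minnP => m _; apply; apply/asboolP.
Qed.

Lemma dist_adj g h : adj_vertices S g h -> dist S g h <= 1.
Proof.
move=> [e [[-> ->]|[-> ->]]].
  apply: (@dist_le _ _ [:: fsval e.2]); last by rewrite word_val1.
  by apply/is_word1/sym_gens_gen/fsvalP.
apply: (@dist_le _ _ [:: (fsval e.2)^-1]); last by rewrite word_val1 mulgK.
by apply/is_word1/sym_gensV/sym_gens_gen/fsvalP.
Qed.

Lemma adj_sym g h : adj_vertices S g h -> adj_vertices S h g.
Proof. by move=> [e [[-> ->]|[-> ->]]]; exists e; [right | left]. Qed.

Lemma adj_mul g s : s \in sym_gens S -> adj_vertices S g (g * s).
Proof.
rewrite !inE => /orP[sS | /imfsetP[r /= rS ->]].
  by exists (g, [` sS]%fset); left.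
by exists (g * r^-1, [` rS]%fset); right; rewrite /tgt /= mulgVK.
Qed.

Lemma adjP g h : adj_vertices S g h <-> g^-1 * h \in sym_gens S.
Proof.
split=> [[e [[-> ->]|[-> ->]]] | /(adj_mul g)]; last by rewrite mulVKg.
  by rewrite mulKg; apply/sym_gens_gen/fsvalP.
by rewrite invgM mulgVK; apply/sym_gensV/sym_gens_gen/fsvalP.
Qed.

Hypothesis genS : generates S.

Lemma dist_word g h : exists w,
  [/\ is_word S w, g * word_val w = h & size w = dist S g h].
Proof.
rewrite /dist; case: pselect => [E|[]].
  by case: ex_minnP => m /asboolP[w [ww Ew sw]] _; exists w; rewrite Ew mulVKg.
have [w [ww Ew]] := genS (g^-1 * h).
by exists (size w); apply/asboolP; exists w.
Qed.

Lemma dist_refl g : dist S g g = 0.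
Proof.
apply/eqP; rewrite -leqn0; apply: (@dist_le g g [::]) => //.
by rewrite /word_val big_nil mulg1.
Qed.

Lemma dist_triangle g1 g2 g3 : dist S g1 g3 <= dist S g1 g2 + dist S g2 g3.
Proof.
have [w1 [W1 E1 <-]] := dist_word g1 g2; have [w2 [W2 E2 <-]] := dist_word g2 g3.
rewrite -size_cat; apply: dist_le; first exact: is_word_cat.
by rewrite word_val_cat mulgA E1.
Qed.

Lemma dist_sym g h : dist S g h = dist S h g.
Proof.
have le g1 g2 : dist S g1 g2 <= dist S g2 g1.
  have [w [W <- <-]] := dist_word g2 g1.
  rewrite -(size_map (fun s => s^-1)) -size_rev.
  by apply: dist_le; [exact: is_word_inv | rewrite word_val_inv mulgK].
by apply/eqP; rewrite eqn_leq !le.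
Qed.

Lemma dist_translate g g1 g2 : dist S (g * g1) (g * g2) = dist S g1 g2.
Proof. by rewrite /dist /word_dist_spec invgM -mulgA mulKg. Qed.

Lemma dist_walk n v i j : (forall l, l < n -> adj_vertices S (v l) (v l.+1)) ->
  i <= j <= n -> dist S (v i) (v j) <= j - i.
Proof.
move=> adj /andP[]; elim: j => [|j IH] ij jn.
  by move: ij; rewrite leqn0 => /eqP ->; rewrite dist_refl.
case: (ltnP i j.+1) ij => [ij _|ji ij]; last first.
  by have -> : i = j.+1 by [lia]; rewrite dist_refl.
have := dist_adj (adj j jn); have := dist_triangle (v i) (v j) (v j.+1).
by have := IH ij (ltnW jn); lia.
Qed.

(** The source of all lower bounds on distances: a function that grows by at
    most one along each edge is bounded by the word length. *)
Lemma lipschitz_dist (f : G -> nat) : f 1 = 0 ->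
  (forall g s, s \in sym_gens S -> f (g * s) <= (f g).+1) ->
  forall g h, f (g^-1 * h) <= dist S g h.
Proof.
move=> f1 fS g h; have [w [W <- <-]] := dist_word g h; rewrite mulKg.
elim/last_ind: w W => [|w s IH] W; first by rewrite /word_val big_nil f1.
rewrite -cats1 word_val_cat word_val1 size_cat addn1.
apply: leq_trans (fS _ _ _) _; first by apply: W; rewrite mem_rcons inE eqxx.
by rewrite ltnS; apply: IH => r rw; apply: W; rewrite mem_rcons inE rw orbT.
Qed.

(** The word read along a loop has trivial value, hence is not geodesic; the
    shorter word provided by FFTP, read from the same base point, is the shorter
    loop.  The condition on the final part of the longer loop is the
    fellow-traveller condition for prefixes beyond the end of the short word. *)
Lemma FFTP_BLSP : FFTP S -> BLSP S.
Proof.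
move=> [k Fk]; exists k.+1 => n v n0 [vn adj].
set w := mkseq (fun i => (v i)^-1 * v i.+1) n.
have Ew j : j <= n -> word_val (take j w) = (v 0)^-1 * v j.
  elim: j => [|j IH] jn; first by rewrite take0 /word_val big_nil mulVg.
  rewrite (take_nth 1) ?size_mkseq // -cats1 word_val_cat word_val1.
  by rewrite (IH (ltnW jn)) nth_mkseq // mulgA mulgK.
have sw : size w = n by rewrite size_mkseq.
have w1 : word_val w = 1 by rewrite -(take_size w) sw Ew // vn mulVg.
have W : is_word S w.
  move=> s /(nthP 1)[i]; rewrite sw => im <-; rewrite nth_mkseq //.
  exact/adjP/adj.
have [| u [U us Eu ku]] := Fk w W.
  have W0 : is_word S [::] by [].
  move=> /(_ [::] W0); rewrite w1 sw /word_val big_nil => /(_ erefl) /=.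
  by rewrite leqNgt n0.
have close j : j <= n -> dist S (v 0 * word_val (take j u)) (v j) <= k.
  move=> jn; rewrite -(mulVKg (v 0) (v j)) dist_translate -Ew //.
  by rewrite dist_sym.
exists (size u), (fun j => v 0 * word_val (take j u)).
split; last by rewrite take0 /word_val big_nil mulg1.
split; first by rewrite -sw.
- split; first by rewrite take_size take0 Eu w1 /word_val big_nil.
  move=> i iu; rewrite (take_nth 1 iu) -cats1 word_val_cat word_val1 mulgA.
  by apply/adj_mul/U; rewrite mem_nth.
- by move=> j ju; rewrite ltnS close //; rewrite sw in us; lia.
- move=> j /andP[uj jn]; rewrite ltnS take_size.
  by have := close j jn; rewrite take_oversize.
Qed.

Lemma BLSP_LSP : BLSP S -> LSP S.
Proof.
move=> [k Bk]; exists k => n v n0 Lv; have [m [u [sh _]]] := Bk n v n0 Lv.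
by exists m, u.
Qed.
End WordMetric.

(** * Spheres, balls and the almost convexity conditions *)

Section AlmostConvexity.
Variables (R : realType) (G : groupType) (S : {fset G}).

Lemma AC_f_mono f f' r0 r1 : r0 <= r1 -> (forall r, r1 < r -> f r <= f' r) ->
  AC_f R S f r0 -> AC_f R S f' r1.
Proof.
move=> r01 ff' A r rr z z' Sz Sz' zz'.
have [p [pp sp]] := A r (leq_ltn_trans r01 rr) z z' Sz Sz' zz'.
by exists p; split=> //; apply: leq_trans sp (ff' r rr).
Qed.

Lemma AC_P2 : AlmostConvex R S -> PoenaruP2 R S.
Proof.
move=> [c [r0 [r0_gt0 A]]]; exists (fun=> c), r0; split=> //.
have H : ((c%:R * harmonic n : R)%R @[n --> \oo] --> (0 : R)%R)%classic.
  by rewrite -(mulr0 (c%:R%R : R)); exact: cvgMl_tmp cvg_harmonic.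
by rewrite /sublinear -cvg_shiftS; apply: H.
Qed.

Lemma P2_MprimeAC : PoenaruP2 R S -> MprimeAC R S.
Proof.
move=> [f [r0 [sub r0_gt0 A]]].
have [N _ HN] := cvgr0_norm_le _ sub _ ltr01.
exists (maxn (maxn r0 N) 2); split; first lia.
apply: AC_f_mono A => [|r rr]; first lia.
have r_gt0 : (0 < r%:R :> R)%R by rewrite ltr0n; lia.
have Nr : N <= r by lia.
have := HN r Nr; rewrite ger0_norm ?divr_ge0 ?ler0n //.
by rewrite ler_pdivrMr // mul1r ler_nat; lia.
Qed.

Lemma MprimeAC_MAC : MprimeAC R S -> MAC R S.
Proof.
move=> [r0 [r0_gt0 A]]; exists r0; split=> //.
by apply: AC_f_mono A => // r _; lia.
Qed.

Lemma norm_vertex g : norm (Vertex R S g) = (dist S 1 g)%:R%R.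
Proof. by []. Qed.

(** A point at integral distance from the identity is a vertex, because the
    inner points of an edge differ from vertices by a fractional distance. *)
Lemma Sph_vertex r z : Sph r z ->
  exists2 g, z = Vertex R S g & dist S 1 g = r.
Proof.
case: z => [g|e [t t01]] /= E.
  by exists g => //; apply/eqP; rewrite -(eqr_nat R) -E.
exfalso; have /andP[t0 t1] := t01; move: E; rewrite /Sph /norm /=.
have noint (m : nat) (s : R) : (0 < s < 1 -> m%:R + s <> r%:R)%R.
  move=> /andP[s0 s1] E; have [rm|mr] := leqP r m.
    by move: rm; rewrite -(ler_nat R) -E; lra.
  by move: mr; rewrite -(ler_nat R) -E -natr1; lra.
rewrite /Num.min; case: ifP => _; apply: noint; lra.
Qed.

(** An inner point is at distance less than one from the end [u], and [u] has
    norm at most [r - 1]. *)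
Lemma closed_edge_cball r e u v (z : rpoint R S) : joins e u v ->
  dist S 1 u < r -> dist S 1 v <= r -> closed_edge e z -> cball r z.
Proof.
move=> j ur vr; have {j u v ur vr} [sr tr str] :
    [/\ dist S 1 (src e) <= r, dist S 1 (tgt e) <= r &
        (dist S 1 (src e) < r) || (dist S 1 (tgt e) < r)].
  by case: j => -[<- <-]; split; rewrite ?ur ?orbT // ltnW.
rewrite /closed_edge /cball /=.
case=> [->|[->|[[t t01] ->]]]; rewrite ?norm_vertex ?ler_nat //.
have /andP[t0 t1] := t01; rewrite /norm /= ge_min; apply/orP.
by case/orP: str; rewrite -(ler_nat R) -natr1; [left | right]; lra.
Qed.

Lemma edge_path_walk u p v : edge_path u p v -> exists f : nat -> G,
  [/\ f 0 = u, f (size p) = v,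
      forall i, i < size p -> adj_vertices S (f i) (f i.+1) &
      forall i, i <= size p -> path_support u p (Vertex R S (f i))].
Proof.
elim: p u => [|e p IH] u /=.
  by move=> ->; exists (fun=> v); split=> // i _; left.
move=> [u' uu' /IH[f [f0 fp adj supp]]].
exists (fun i => if i is j.+1 then f j else u); split=> //.
  by case=> [|i] ip /=; [rewrite f0; exists e | apply: adj].
case=> [|i] ip /=; first by left.
case: (supp i ip) => [[->]|[e' e'p ce]]; right; last first.
  by exists e' => //; rewrite inE e'p orbT.
exists e; first by rewrite inE eqxx.
by case: uu' => -[_ ->]; [right; left | left].
Qed.

Lemma edge_path_in_cball r u v w : adj_vertices S u v -> adj_vertices S v w ->
  dist S 1 u <= r -> dist S 1 v < r -> dist S 1 w <= r ->
  exists2 p, path_between (Vertex R S u) (Vertex R S w) p (cball r) & size p = 2.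
Proof.
move=> [e1 j1] [e2 j2] ur vr wr; exists [:: e1; e2] => //; exists u, w.
split=> //; first by exists v => //; exists w.
move=> z [-> | [e]]; first by rewrite /cball /norm /= ler_nat.
rewrite !inE => /orP[]/eqP->; last exact: closed_edge_cball j2 vr wr.
have j1' : joins e1 v u by case: j1 => -[]; [right | left].
exact: closed_edge_cball j1' vr ur.
Qed.

End AlmostConvexity.

(** * The product generating set *)

Lemma fg_of_letter_inv (a : letter bool) :
  fg_of [:: letter_inv a] = (fg_of [:: a] : F2)^-1.
Proof. exact: (fg_of_inv [:: a]). Qed.

Definition len (g : F2) : nat := size (fg_word g).

Lemma len_mul_letter (g : F2) a : len (g * fg_of [:: a]) = (len g).+1 \/
  len g = (len (g * fg_of [:: a])).+1.
Proof. exact: size_mul_letter. Qed.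

Lemma len_mul_two_letters (g : F2) a b : len (g * fg_of [:: a]) = (len g).+1 ->
  len (g * fg_of [:: a] * fg_of [:: b]) = (len g).+2 \/ b = letter_inv a.
Proof. exact: size_mul_two_letters. Qed.

Section StandardGenerators.

(** A letter of a word over [S1] is a pair [(i, a)] where [a] is a letter of the
    free group and [i] tells in which factor it lies, [true] being the second. *)
Local Notation letter1 := (bool * letter bool)%type.
Implicit Types (l m : letter1) (ws : seq letter1).

Definition gen1 l : F2xF2 :=
  if l.1 then (1, fg_of [:: l.2]) else (fg_of [:: l.2], 1).

Definition proj (i : bool) ws : seq (letter bool) :=
  [seq l.2 | l <- ws & l.1 == i].

Definition inv1 l : letter1 := (l.1, letter_inv l.2).

Lemma sym_gens1P s : reflect (exists l, s = gen1 l) (s \in sym_gens S1).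
Proof.
apply: (iffP idP) => [|[[i [x e]] ->]].
  have base r : r \in S1 -> exists i x, r = gen1 (i, (x, false)).
    move=> /in_fset4[] ->.
    - by exists false, false.
    - by exists false, true.
    - by exists true, false.
    - by exists true, true.
  move=> /sym_gens_cases[/base[i [x ->]] | [r /base[i [x ->]] ->]].
    by exists (i, (x, false)).
  exists (i, (x, true)); case: i => /=; congr pair;
    by rewrite ?invg1 // -fg_gen_inv.
have base : gen1 (i, (x, false)) \in S1.
  apply/in_fset4; case: i x => -[].
  - exact: Or44.
  - exact: Or43.
  - exact: Or42.
  - exact: Or41.
case: e; last exact: sym_gens_gen.
have -> : gen1 (i, (x, true)) = (gen1 (i, (x, false)))^-1.
  by case: i {base} => /=; congr pair; rewrite ?invg1 // -fg_gen_inv.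
exact/sym_gensV/sym_gens_gen.
Qed.

Lemma is_word1P w : is_word S1 w -> exists ws, w = map gen1 ws.
Proof.
elim: w => [|s w IH] W; first by exists [::].
have [ws ->] : exists ws, w = map gen1 ws.
  by apply: IH => r rw; apply: W; rewrite inE rw orbT.
have /sym_gens1P[l ->] : s \in sym_gens S1 by apply: W; rewrite inE eqxx.
by exists (l :: ws).
Qed.

Lemma is_word_gen1 ws : is_word S1 (map gen1 ws).
Proof. by move=> s /mapP[l _ ->]; apply/sym_gens1P; exists l. Qed.

Definition eval1 ws : F2xF2 := word_val (map gen1 ws).

Lemma eval1_cat ws ws' : eval1 (ws ++ ws') = eval1 ws * eval1 ws'.
Proof. by rewrite /eval1 map_cat word_val_cat. Qed.

Lemma eval1_cons l ws : eval1 (l :: ws) = gen1 l * eval1 ws.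
Proof. exact: word_val_cons. Qed.

Lemma eval1_proj ws : eval1 ws = (fg_of (proj false ws), fg_of (proj true ws)).
Proof.
elim: ws => [|[[] a] ws IH]; first by rewrite /eval1 /word_val big_nil.
  by rewrite eval1_cons IH; congr pair; rewrite ?mul1g // -fg_of_cat.
by rewrite eval1_cons IH; congr pair; rewrite ?mul1g // -fg_of_cat.
Qed.

Lemma size_proj ws : size ws = size (proj false ws) + size (proj true ws).
Proof. by elim: ws => [|[[] a] ws IH] //=; rewrite IH ?addnS. Qed.

Definition word1 (p : F2xF2) : seq letter1 :=
  map (pair false) (fg_word p.1) ++ map (pair true) (fg_word p.2).

Lemma eval1_word1 p : eval1 (word1 p) = p.
Proof.
have projE i j (u : seq (letter bool)) :
    proj i (map (pair j) u) = if j == i then u else [::].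
  elim: u => [|a u IH] /=; first by case: ifP.
  by rewrite /proj /=; case: (j == i) IH => IH; rewrite /= -/(proj _ _) IH.
rewrite eval1_proj /word1 /proj !filter_cat !map_cat -!/(proj _ _) !projE /=.
rewrite cats0.
by rewrite !fg_of_word; case: p.
Qed.

Lemma generates_S1 : generates S1.
Proof.
move=> p; exists (map gen1 (word1 p)); split; first exact: is_word_gen1.
exact: eval1_word1.
Qed.

Definition norm1 (p : F2xF2) : nat := len p.1 + len p.2.

Lemma mul_gen1 g h i a : ((g, h) : F2xF2) * gen1 (i, a) =
  if i then (g, h * fg_of [:: a]) else (g * fg_of [:: a], h).
Proof. by case: i; congr pair; exact: mulg1. Qed.

Lemma norm1_mul (p : F2xF2) l : norm1 (p * gen1 l) = (norm1 p).+1 \/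
  norm1 p = (norm1 (p * gen1 l)).+1.
Proof.
case: p l => [g h] [i a]; rewrite mul_gen1 /norm1; case: i => /=.
  by have := len_mul_letter h a; lia.
by have := len_mul_letter g a; lia.
Qed.

Lemma norm1_le_dist (p q : F2xF2) : norm1 (p^-1 * q) <= dist S1 p q.
Proof.
apply: (lipschitz_dist generates_S1) => // {p q}p s /sym_gens1P[l ->].
by case: (norm1_mul p l); lia.
Qed.

Lemma reduced_geodesic ws : (forall i, reduced (proj i ws)) ->
  geodesic S1 (map gen1 ws).
Proof.
move=> red w' W' Ew'; apply: leq_trans (@dist_le _ S1 1 _ w' W' (mul1g _)).
apply: leq_trans (norm1_le_dist _ _); 
rewrite invg1 mul1g Ew' -/(eval1 _) eval1_proj.
by rewrite size_map size_proj /norm1 /len /= !reduced_reduce.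
Qed.

Lemma first_in_factor i a ws u : proj i ws = a :: u ->
  exists q r, ws = q ++ (i, a) :: r /\ all (fun m => m.1 != i) q.
Proof.
elim: ws => [|[j b] ws IH] //; rewrite /proj /=; case: eqP => [-> [-> _]|ji].
  by exists [::], ws.
by move=> /IH[q [r [-> qi]]]; exists ((j, b) :: q), r;
  rewrite /= qi andbT; split=> //; apply/eqP.
Qed.

(** Cancellation in one factor, lifted to the word: between two letters that
    become adjacent in the projection there are only letters of the other
    factor. *)
Lemma reduced_or_cancels ws : (forall i, reduced (proj i ws)) \/
  exists p l q r,
    ws = p ++ l :: q ++ inv1 l :: r /\ all (fun m => m.1 != l.1) q.
Proof.
elim: ws => [|[i a] ws [red|[p [l [q [r [-> ql]]]]]]]; first by left.
  have [redi|] := boolP (reduced (a :: proj i ws)).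
    left=> j; rewrite /proj /=; case: eqP => [<-|_]; [exact: redi | exact: red].
  case E: (proj i ws) (red i) => [|b u] //= -> ; rewrite andbT negbK => /eqP Eb.
  right; have [q [r [-> qi]]] := first_in_factor E.
  by exists [::], (i, a), q, r; rewrite /inv1 /= -Eb.
by right; exists ((i, a) :: p), l, q, r.
Qed.

Lemma gen1_inv l : gen1 (inv1 l) = (gen1 l)^-1.
Proof. by case: l => [[] a]; congr pair; rewrite ?invg1 // -fg_of_inv. Qed.

Lemma gen1_commute l m : m.1 != l.1 -> commute (gen1 m) (gen1 l).
Proof.
by case: l m => [[] a] [[] b] //= _; congr pair; rewrite mulg1 mul1g.
Qed.

Lemma eval1_commute l q : all (fun m => m.1 != l.1) q ->
  eval1 q * gen1 l = gen1 l * eval1 q.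
Proof.
elim: q => [|m q IH] /=; first by rewrite /eval1 /word_val big_nil mulg1 mul1g.
move=> /andP[ml ql]; rewrite eval1_cons -mulgA IH // !mulgA.
by rewrite gen1_commute.
Qed.

Lemma dist_eval1_take ws i d :
  dist S1 (eval1 (take i ws)) (eval1 (take (i + d) ws)) <= d.
Proof.
rewrite takeD eval1_cat.
apply: (@leq_trans (size (map gen1 (take d (drop i ws))))).
  by apply: dist_le => //; apply: is_word_gen1.
by rewrite size_map size_take; case: ltnP.
Qed.

(** With [w = p s q s^-1 r] and [u = p q r], a prefix of [w] ending inside [q] is
    a prefix of [u] times [s], since [s] can be moved past [q], and a prefix
    reaching [s^-1] equals the prefix of [u] that is two letters shorter. *)
Lemma FFTP_S1 : FFTP S1.
Proof.
exists 2 => w /is_word1P[ws ->] ngeo.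
case: (reduced_or_cancels ws) => [/reduced_geodesic // |
  [p [l [q [r [E ql]]]]]].
have slide q' : all (fun m => m.1 != l.1) q' ->
    eval1 (l :: q') = eval1 q' * gen1 l.
  by move=> q'l; rewrite eval1_cons eval1_commute.
have slideV r' : eval1 (l :: q ++ inv1 l :: r') = eval1 (q ++ r').
  rewrite -cat_cons eval1_cat slide // eval1_cons gen1_inv.
  by rewrite -mulgA mulVKg eval1_cat.
pose us := p ++ q ++ r; exists (map gen1 us); split; first exact: is_word_gen1.
- by rewrite E /us !size_map !size_cat /= size_cat /=; lia.
- by rewrite -!/(eval1 _) E /us !eval1_cat slideV eval1_cat.
move=> j; rewrite -!map_take -!/(eval1 _).
have [jp|pj] := leqP j (size p).
  by rewrite E /us !takel_cat // dist_refl.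
have [jq|qj] := leqP j (size p + size q).+1.
  have [i Ej] : exists i, j = (size p + i).+1 by exists (j - (size p).+1); lia.
  have iq : i <= size q by lia.
  have -> : eval1 (take j ws) = eval1 (take (size p + i) us) * gen1 l.
    rewrite E /us Ej -addnS !takeD !take_size_cat // !drop_size_cat //=.
    rewrite !takel_cat //.
    rewrite !eval1_cat slide ?mulgA //.
    apply/allP => m /mem_take; exact: (allP ql).
  have := dist_eval1_take us (size p + i) 1; rewrite addn1 -Ej.
  set g := eval1 _.
  have := dist_triangle generates_S1 (g * gen1 l) g (eval1 (take j us)).
  suff : dist S1 (g * gen1 l) g <= 1 by lia.
  by rewrite (dist_sym generates_S1); apply/dist_adj/adj_mul/sym_gens1P; exists l.
have [i Ej] : exists i, j = (size p + (size q + i)).+2.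
  by exists (j - (size p + size q).+2); lia.
have -> : eval1 (take j ws) = eval1 (take (size p + (size q + i)) us).
  have take_add (s s' : seq (bool * letter bool)) k :
      take (size s + k) (s ++ s') = s ++ take k s'.
    by rewrite takeD take_size_cat // drop_size_cat.
  have -> : j = size p + (size q + i.+1).+1 by lia.
  rewrite E /us !take_add /= !take_add /=.
  by rewrite !eval1_cat slideV eval1_cat.
by have := dist_eval1_take us (size p + (size q + i)) 2; rewrite addn2 -Ej.
Qed.

Lemma dist_S1 (p : F2xF2) : dist S1 1 p = norm1 p.
Proof.
apply/eqP; rewrite eqn_leq; apply/andP; split; last first.
  by rewrite -{1}(mul1g p) -{1}invg1 norm1_le_dist.
have -> : norm1 p = size (map gen1 (word1 p)).
  by rewrite size_map size_cat !size_map.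
apply: dist_le; first exact: is_word_gen1.
by rewrite mul1g; exact: eval1_word1.
Qed.

(** Let [v = u l m] on the sphere of [u].  If [u l] is outside the ball, then
    either [l] and [m] lie in the same factor and [m] undoes [l], or they
    commute, and since the lengths in the two factors add up the intermediate
    point [u m] is inside the ball. *)
Lemma AC_S1 (R : realType) : AlmostConvex R S1.
Proof.
exists 2, 1%N; split=> // r _ z z' /Sph_vertex[u -> ur] /Sph_vertex[v -> vr].
rewrite /= (ler_nat R _ 2) => uv2.
have [w [/is_word1P[ws ->] Ev sw]] := dist_word generates_S1 u v.
rewrite -{}sw size_map in uv2; rewrite !dist_S1 in ur vr.
have cball_path (m : F2xF2) :
    adj_vertices S1 u m -> adj_vertices S1 m v -> norm1 m < r ->
    exists p, path_between (Vertex R S1 u) (Vertex R S1 v) p (cball r) /\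
              size p <= 2.
  move=> um mv mr; have [|||p pp sp] := edge_path_in_cball R um mv (r := r).
  - by rewrite dist_S1 ur.
  - by rewrite dist_S1.
  - by rewrite dist_S1 vr.
  by exists p; rewrite sp.
have adj1 (g : F2xF2) l : adj_vertices S1 g (g * gen1 l).
  by apply/adj_mul/sym_gens1P; exists l.
have trivial : u = v ->
    exists p, path_between (Vertex R S1 u) (Vertex R S1 v) p (cball r) /\
              size p <= 2.
  move=> <-; exists [::]; split=> //; exists u, u; split=> // y [->|[] //].
  by rewrite /cball /norm /= ler_nat dist_S1 ur.
case: ws uv2 Ev => [|l [|m [|//]]] _;
  rewrite -/(eval1 _) ?eval1_cons /eval1 /word_val big_nil mulg1.
- exact: trivial.
- by move=> Ev; have := norm1_mul u l; rewrite Ev ur vr; lia.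
rewrite mulgA => Ev.
have [nl|] := norm1_mul u l; last first.
  by move=> nl; apply: (cball_path (u * gen1 l)) => //; [rewrite -Ev | lia].
have vu : norm1 (u * gen1 l * gen1 m) = norm1 u by rewrite Ev ur vr.
case: l m u => [i a] [j b] [g h] in ur cball_path trivial Ev nl vu *.
have [ij|ij] := eqVneq i j.
  apply: trivial; rewrite -Ev; move: nl vu; rewrite -ij !mul_gen1 /norm1.
  case: (i); rewrite !mul_gen1 /= => nl vu.
    have := @len_mul_two_letters h a b; case; [lia | lia | move=> ->].
    by rewrite fg_of_letter_inv mulgK.
    have := @len_mul_two_letters g a b; case; [lia | lia | move=> ->].
    by rewrite fg_of_letter_inv mulgK.
have vE : (g, h) * gen1 (j, b) * gen1 (i, a) = v.
  by rewrite -Ev -!mulgA; congr (_ * _); apply: gen1_commute; rewrite /= eq_sym.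
apply: (cball_path ((g, h) * gen1 (j, b))) => //; first by rewrite -vE.
move: nl vu; rewrite !mul_gen1 /norm1.
by move: ur; rewrite /norm1; case: (i) (j) ij => [] [] // _;
  rewrite !mul_gen1 /=; lia.
Qed.

End StandardGenerators.

(** * A lower bound for the slanted generating set *)

Implicit Types (g h : F2) (z : F2xF2).
Local Notation word := (seq (letter bool)).

Definition height g : int := heights (fg_word g).
Definition c_exp h : int := exponent (fun i : bool => Posz (~~ i)) (fg_word h).
Definition t_exp h : int := exponent (fun i : bool => Posz i) (fg_word h).

Lemma heightM g h : height (g * h) = (height g + height h)%R.
Proof. exact: exponentM. Qed.
Lemma c_expM g h : c_exp (g * h) = (c_exp g + c_exp h)%R.
Proof. exact: exponentM. Qed.
Lemma t_expM g h : t_exp (g * h) = (t_exp g + t_exp h)%R.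
Proof. exact: exponentM. Qed.
Lemma c_expV h : c_exp h^-1 = (- c_exp h)%R.
Proof. exact: exponentV. Qed.
Lemma t_expV h : t_exp h^-1 = (- t_exp h)%R.
Proof. exact: exponentV. Qed.
Lemma exponents_one : (height 1 = 0 /\ c_exp 1 = 0 /\ t_exp 1 = 0)%R.
Proof. by rewrite /height /c_exp /t_exp /heights /exponent /= !big_nil. Qed.

Lemma c_exp_letter (a : letter bool) :
  c_exp (fg_of [:: a] : F2) = (if a.1 then 0 else if a.2 then -1 else 1)%R.
Proof. by rewrite /c_exp /= /exponent big_seq1; case: a => [[] []]. Qed.

Lemma t_exp_letter (a : letter bool) :
  t_exp (fg_of [:: a] : F2) = (if a.1 then (if a.2 then -1 else 1) else 0)%R.
Proof. by rewrite /t_exp /= /exponent big_seq1; case: a => [[] []]. Qed.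

Lemma height_letter (a : letter bool) :
  height (fg_of [:: a] : F2) = (if a.2 then -1 else 1)%R.
Proof. by rewrite /height /heights /= /exponent big_seq1; case: a => [[] []]. Qed.

Lemma c_exp_len h : `|c_exp h|%N <= len h.
Proof. by apply: exponent_bound => -[]. Qed.

Lemma lenM g h : len (g * h) <= len g + len h.
Proof. exact: size_fg_mul. Qed.
Lemma lenV g : len g^-1 = len g.
Proof. exact: size_fg_inv. Qed.
Lemma len_of (w : word) : len (fg_of w : F2) <= size w.
Proof. exact: size_reduce. Qed.

(** The letter of the second factor that accompanies [a] in a generator of [S2]:
    [c^-1] for [x] and [y], and [c] for their inverses. *)
Definition c_letter (a : letter bool) : letter bool := (false, ~~ a.2).

Definition gen_slant (a : letter bool) : F2xF2 :=
  (fg_of [:: a], fg_of [:: c_letter a]).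
Definition gen_second (a : letter bool) : F2xF2 := (1, fg_of [:: a]).

Lemma gen_slant_inv a : gen_slant (letter_inv a) = (gen_slant a)^-1.
Proof.
by case: a => x e; congr pair; rewrite -fg_of_inv.
Qed.

Lemma gen_second_inv a : gen_second (letter_inv a) = (gen_second a)^-1.
Proof. by congr pair; rewrite ?invg1 -?fg_of_inv. Qed.

Lemma sym_gens2P z : reflect (exists a, z = gen_slant a \/ z = gen_second a)
  (z \in sym_gens S2).
Proof.
have slantE x : gen_slant (x, false) = if x then gen_b else gen_a.
  by case: x; congr pair; rewrite ?invg1 ?mulg1 ?mul1g ?fg_gen_inv.
apply: (iffP idP) => [|[a az]].
  have base s : s \in S2 -> exists a, s = gen_slant a \/ s = gen_second a.
    move=> /in_fset4[] ->.
    - by exists (false, false); left; rewrite slantE.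
    - by exists (true, false); left; rewrite slantE.
    - by exists (false, false); right.
    - by exists (true, false); right.
  move=> /sym_gens_cases[/base // | [s /base[a sa] ->]].
  exists (letter_inv a); rewrite gen_slant_inv gen_second_inv.
  by case: sa => ->; [left | right].
have base b : gen_slant (b, false) \in S2 /\ gen_second (b, false) \in S2.
  rewrite slantE; split; apply/in_fset4; case: b.
  - exact: Or42.
  - exact: Or41.
  - exact: Or44.
  - exact: Or43.
case: a az => b [] az; last first.
  by apply: sym_gens_gen; case: (base b) => ? ?; case: az => ->.
rewrite -[(b, true)]/(letter_inv (b, false)) gen_slant_inv gen_second_inv in az.
by case: az => ->; apply/sym_gensV/sym_gens_gen; case: (base b).
Qed.

(** The word length of the image of [z] in the quotient in which [c] and [t]
    commute: a shortest word there has as many letters [a], [b] and inverses as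
    [z.1] has letters, then the power of [c] that corrects the height, and the
    power of [t]. *)
Definition norm2 z : nat :=
  len z.1 + `|(height z.1 + c_exp z.2)%R|%N + `|t_exp z.2|%N.

Lemma norm2_mul z s : s \in sym_gens S2 -> norm2 (z * s) <= (norm2 z).+1.
Proof.
case: z => g h /sym_gens2P[a [->|->]]; rewrite /norm2 /=.
  rewrite heightM c_expM t_expM height_letter c_exp_letter t_exp_letter /=.
  have := lenM g (fg_of [:: a]); have := len_of [:: a].
  by case: (a.2) => /=; lia.
rewrite mulg1 c_expM t_expM c_exp_letter t_exp_letter.
by case: a => [[] []] /=; lia.
Qed.

(** [low w] is the value of the word [w] read in the generators [a] and [b] of
    [S2] in place of [x] and [y]; [up w] is its left translate by [t].  These two
    points are adjacent when the exponent sum of [w] is zero, since their second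
    coordinates are then [1] and [t]. *)
Definition twist (w : word) : word := map c_letter w.
Definition low (w : word) : F2xF2 := (fg_of w, fg_of (twist w)).
Local Notation t_letter := ((true, false) : letter bool).
Definition up (w : word) : F2xF2 := (fg_of w, fg_of (t_letter :: twist w)).

Lemma low_cat w a : low (w ++ [:: a]) = low w * gen_slant a.
Proof. by congr pair; rewrite /twist ?map_cat fg_of_cat. Qed.

Lemma up_cat w a : up (w ++ [:: a]) = up w * gen_slant a.
Proof. by congr pair; rewrite /twist ?map_cat -?cat_cons fg_of_cat. Qed.

Lemma word_val_slant w : word_val (map gen_slant w) = low w.
Proof.
elim/last_ind: w => [|w a IH]; first by rewrite /word_val big_nil.
by rewrite -cats1 map_cat word_val_cat word_val1 IH low_cat.
Qed.

Lemma up_low w : up w = gen_second t_letter * low w.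
Proof. by congr pair; rewrite ?mul1g // -fg_of_cat. Qed.

Lemma slant_word w : is_word S2 (map gen_slant w).
Proof. by move=> s /mapP[a _ ->]; apply/sym_gens2P; exists a; left. Qed.

Lemma second_word w : is_word S2 (map gen_second w).
Proof. by move=> s /mapP[a _ ->]; apply/sym_gens2P; exists a; right. Qed.

Lemma word_val_second w : word_val (map gen_second w) = (1, fg_of w).
Proof.
elim: w => [|a w IH]; first by rewrite /word_val big_nil.
by rewrite /= word_val_cons IH; congr pair; rewrite ?mul1g // -fg_of_cat.
Qed.

Lemma generates_S2 : generates S2.
Proof.
move=> [g h]; pose h' : F2 := fg_of (twist (fg_word g)).
exists (map gen_slant (fg_word g) ++ map gen_second (fg_word (h'^-1 * h))).
split; first by apply: is_word_cat; [exact: slant_word | exact: second_word].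
rewrite word_val_cat word_val_slant word_val_second /low !fg_of_word.
by congr pair; rewrite ?mulg1 ?mulVKg.
Qed.

Lemma norm2_le_dist z1 z2 : norm2 (z1^-1 * z2) <= dist S2 z1 z2.
Proof.
apply: (lipschitz_dist generates_S2); last exact: norm2_mul.
by rewrite /norm2 /=; have [-> [-> ->]] := exponents_one.
Qed.

Lemma len1_le_dist z1 z2 : len (z1.1^-1 * z2.1) <= dist S2 z1 z2.
Proof.
by apply: leq_trans (norm2_le_dist z1 z2); rewrite /norm2 -addnA leq_addr.
Qed.

Lemma len2_le_dist z1 z2 : len (z1.2^-1 * z2.2) <= dist S2 z1 z2.
Proof.
apply: (@lipschitz_dist _ _ generates_S2 (fun z => len z.2)) => //.
move=> z s /sym_gens2P[a [->|->]];
  apply: leq_trans (lenM _ _) _; rewrite -addn1 leq_add2l; exact: len_of.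
Qed.

Lemma c_exp_le_dist z1 z2 : `|(c_exp z2.2 - c_exp z1.2)%R|%N <= dist S2 z1 z2.
Proof.
apply: leq_trans (len2_le_dist z1 z2); apply: leq_trans (c_exp_len _).
by rewrite c_expM c_expV addrC.
Qed.

Lemma parallel_le_dist g1 g2 h :
  len (g1^-1 * g2) + `|height (g1^-1 * g2)|%N <= dist S2 (g1, h) (g2, h).
Proof.
apply: leq_trans (norm2_le_dist _ _).
have -> : ((g1, h) : F2xF2)^-1 * (g2, h) = (g1^-1 * g2, 1).
  by congr pair; exact: mulVg.
by rewrite /norm2; have [_ [-> ->]] := exponents_one; rewrite addr0 addn0.
Qed.

(** One side of the wall dual to the edge from [1] to [t] in the tree of the
    second factor. *)
Definition upper z : bool := ohead (fg_word z.2) == Some t_letter.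

Lemma len_apart h1 h2 :
  (ohead (fg_word h1) == Some t_letter)
    != (ohead (fg_word h2) == Some t_letter) ->
  len (h1^-1 * h2) = len h1 + len h2.
Proof.
move=> ne; have [p [u [v [E1 E2 E]]]] := fg_mulVg_word h1 h2.
rewrite /len E; move: ne; rewrite E1 E2; case: p {E1 E2} => [|a p] /=.
  by rewrite size_cat /word_inv size_rev size_map.
by rewrite eqxx.
Qed.

(** The second coordinate of a path changing sides passes through [1] and [t],
    whose exponents of [c] vanish. *)
Lemma upper_dist z1 z2 :
  upper z1 != upper z2 -> `|c_exp z2.2|%N <= dist S2 z1 z2.
Proof.
move=> ne; apply: leq_trans (len2_le_dist z1 z2).
by rewrite len_apart //; have := c_exp_len z2.2; lia.
Qed.

(** [twist w] is a word in [c] alone, so nothing cancels the leading [t]. *)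
Lemma upper_up w : upper (up w).
Proof.
have no_t b : b \in reduce (twist w) -> b.1 = false.
  by move=> /mem_reduce/mapP[a _ ->].
rewrite /upper /up /=; case: (reduce (twist w)) no_t => [|b s] no_t //=.
have b1 : b.1 = false by apply: no_t; rewrite inE eqxx.
by rewrite (_ : b == _ = false) //; apply/eqP => Eb; rewrite Eb in b1.
Qed.

Lemma lower_low w : ~~ upper (low w).
Proof.
have no_t b : b \in reduce (twist w) -> b.1 = false.
  by move=> /mem_reduce/mapP[a _ ->].
rewrite /upper /low /=; case: (reduce (twist w)) no_t => [|b s] no_t //=.
have b1 : b.1 = false by apply: no_t; rewrite inE eqxx.
by apply/eqP => -[Eb]; rewrite Eb in b1.
Qed.

Local Notation t_elt := (fg_of [:: t_letter] : F2).

Lemma len_eq0 g : len g = 0 -> g = 1.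
Proof. by move=> /size0nil E; apply: val_inj. Qed.

(** An edge changing sides has second coordinates [t] and [1], the only points of
    the two sides at distance one; it is then an edge labelled [t], because the
    exponent of [t] already uses up the whole unit of length. *)
Lemma crossing_down z1 z2 : adj_vertices S2 z1 z2 -> upper z1 -> ~~ upper z2 ->
  exists g, z1 = (g, t_elt) /\ z2 = (g, 1).
Proof.
case: z1 z2 => [g1 h1] [g2 h2] /dist_adj d1 u1 u2.
have ne : upper (g1, h1) != upper (g2, h2) by rewrite u1 (negPf u2).
have := leq_trans (len2_le_dist _ _) d1; rewrite /= len_apart // => sh.
have [h1E h20] : h1 = t_elt /\ len h2 = 0.
  move: u1 sh; rewrite /upper /len /=; case E: (fg_word h1) => [|b [|c s]] //=.
  by move=> /eqP[Eb] h2s; split; [apply: val_inj; rewrite /= E Eb | lia].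
have h2E := len_eq0 h20; subst h1 h2.
have := leq_trans (norm2_le_dist _ _) d1.
rewrite /norm2 /= mulg1 t_expV t_exp_letter /= => ng.
have E : g1^-1 * g2 = 1.
  by apply: len_eq0; move: ng; rewrite addn1 ltnS leqn0 addn_eq0 => /andP[/eqP].
by exists g1; split=> //; congr pair; rewrite -(mulVKg g1 g2) E mulg1.
Qed.

Lemma crossing_up z1 z2 : adj_vertices S2 z1 z2 -> ~~ upper z1 -> upper z2 ->
  exists g, z1 = (g, 1) /\ z2 = (g, t_elt).
Proof.
move=> /adj_sym adj u1 u2.
by have [g [-> ->]] := crossing_down adj u2 u1; exists g.
Qed.

Lemma bool_switch (P : nat -> bool) i j : i <= j -> P i != P j ->
  exists l, [/\ i <= l, l < j, P l = P i & P l.+1 = ~~ P i].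
Proof.
elim: j => [|j IH]; first by rewrite leqn0 => /eqP ->; rewrite eqxx.
rewrite leq_eqVlt => /orP[/eqP ->|]; first by rewrite eqxx.
rewrite ltnS => ij ne; have [E|ne'] := eqVneq (P i) (P j); last first.
  by have [l [il lj El El1]] := IH ij ne'; exists l; split=> //; apply: ltnW.
exists j; rewrite ij ltnSn E; split=> //.
by move: ne; rewrite E; case: (P j) (P j.+1) => [] [].
Qed.

Section Walks.
Variables (n : nat) (f : nat -> F2xF2).
Hypothesis adj : forall i, i < n -> adj_vertices S2 (f i) (f i.+1).

Lemma walk_down i j : i <= j <= n -> upper (f i) -> ~~ upper (f j) ->
  exists l g, [/\ i <= l, l < j, f l = (g, t_elt) & f l.+1 = (g, 1)].
Proof.
move=> /andP[ij jn] ui uj.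
have [|l [il lj El El1]] := @bool_switch (fun k => upper (f k)) i j ij.
  by rewrite ui (negPf uj).
have ln : l < n by lia.
have [||g [E E']] := crossing_down (adj ln); first by rewrite El.
  by rewrite El1 negbK.
by exists l, g.
Qed.

Lemma walk_up i j : i <= j <= n -> ~~ upper (f i) -> upper (f j) ->
  exists l g, [/\ i <= l, l < j, f l = (g, 1) & f l.+1 = (g, t_elt)].
Proof.
move=> /andP[ij jn] ui uj.
have [|l [il lj El El1]] := @bool_switch (fun k => upper (f k)) i j ij.
  by rewrite uj (negPf ui).
have ln : l < n by lia.
have [||g [E E']] := crossing_up (adj ln); first by rewrite El.
  by rewrite El1.
by exists l, g.
Qed.
End Walks.

Lemma twist_inv w : twist (word_inv w) = word_inv (twist w).
Proof. by rewrite /word_inv /twist map_rev -!map_comp. Qed.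

Lemma c_exp_twist w : c_exp (fg_of (twist w) : F2) = (- heights w)%R.
Proof.
rewrite /c_exp exponent_reduce /heights /exponent big_map -sumrN.
by apply: eq_bigr => -[x e] _ /=; case: e.
Qed.

Lemma twist1 w : fg_of (twist w) = 1 ->
  low w = (fg_of w, 1) /\ up w = (fg_of w, t_elt).
Proof.
by move=> tw; rewrite /low /up -cat1s fg_of_cat tw mulg1.
Qed.

Lemma adj_top w : fg_of (twist w) = 1 -> adj_vertices S2 (low w) (up w).
Proof.
move=> /twist1[-> ->].
have -> : (fg_of w, t_elt) = ((fg_of w, 1) : F2xF2) * gen_second t_letter.
  by congr pair; rewrite ?mul1g ?mulg1.
by apply/adj_mul/sym_gens2P; exists t_letter; right.
Qed.

Local Notation x_letter := ((false, false) : letter bool).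
Local Notation yV_letter := ((true, true) : letter bool).

(** * Minimal almost convexity fails for the slanted generating set *)

Section NotMAC.
Variable n : nat.
Hypothesis n_gt0 : 0 < n.

Definition peak_tail : word := nseq n yV_letter ++ nseq n.-1 x_letter.
Definition peak : word := nseq n yV_letter ++ nseq n x_letter.

Lemma peakE : peak = peak_tail ++ [:: x_letter].
Proof.
rewrite /peak /peak_tail -catA; congr cat.
by rewrite -{1}(prednK n_gt0) -addn1 nseqD.
Qed.

Lemma peak_reduced m : reduced (nseq n yV_letter ++ nseq m x_letter).
Proof. by apply: reduced_nseq_cat; [exact: reduced_nseq | case: m]. Qed.

Lemma twist_peak : fg_of (twist peak) = 1.
Proof.
have -> : peak = word_inv (nseq n (true, false)) ++ nseq n x_letter.
  by rewrite word_inv_nseq.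
rewrite /twist map_cat -/(twist _) twist_inv.
have -> : map c_letter (nseq n x_letter) = twist (nseq n (true, false)).
  by rewrite /twist !map_nseq.
by apply: val_inj; exact: reduce_invl.
Qed.

Lemma dist_peak : dist S2 1 (low peak) = (2 * n)%N.
Proof.
apply/eqP; rewrite eqn_leq; apply/andP; split.
  have <- : size (map gen_slant peak) = (2 * n)%N.
    by rewrite size_map size_cat !size_nseq; lia.
  by apply: dist_le; [exact: slant_word | rewrite word_val_slant mul1g].
have := len1_le_dist 1 (low peak); rewrite /= invg1 mul1g /len /=.
by rewrite reduced_reduce ?peak_reduced // size_cat !size_nseq; lia.
Qed.

Lemma dist_peak_tail : dist S2 1 (up peak_tail) = (2 * n)%N.
Proof.
apply/eqP; rewrite eqn_leq; apply/andP; split.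
  have <- : size (gen_second t_letter :: map gen_slant peak_tail) = (2 * n)%N.
    by rewrite /= size_map size_cat !size_nseq; lia.
  apply: dist_le; last by rewrite word_val_cons word_val_slant mul1g up_low.
  move=> s; rewrite inE => /orP[/eqP->|]; last exact: slant_word.
  by apply/sym_gens2P; exists t_letter; right.
have := norm2_le_dist 1 (up peak_tail); rewrite invg1 mul1g /norm2 /=.
rewrite -cat1s fg_of_cat t_expM t_exp_letter /=.
have -> : t_exp (fg_of (twist peak_tail) : F2) = 0%R.
  rewrite /t_exp exponent_reduce /exponent big_map big1 // => -[a e] _ /=.
  by case: e.
rewrite /len /= reduced_reduce ?peak_reduced // size_cat !size_nseq; lia.
Qed.

(** The hypothesis bounds the number of negative letters of [g] by [n - 1], so
    [g] branches off from [y^-n x^n] before its final block [x^n], and this block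
    survives in [g^-1 y^-n x^n]. *)
Lemma far_from_peak g : len g + `|height g|%N < (2 * n)%N ->
  (2 * n)%N <= len (g^-1 * fg_of peak) + `|height (g^-1 * fg_of peak)|%N.
Proof.
move=> gn; have [p [u [v [Eg Ep E]]]] := fg_mulVg_word g (fg_of peak : F2).
have neg := count_sign_bound true (fg_word g).
have pos := count_sign_bound false (fg_word (g^-1 * (fg_of peak : F2))).
apply: leq_trans pos; rewrite leq_mul2l [fg_word _]E orFb.
move: Ep; rewrite /= reduced_reduce ?peak_reduced // => Ep.
have pn : size p < n.
  have : count (fun a : letter bool => a.2 == true) p < n.
    move: neg gn; rewrite Eg count_cat -Eg /len /height; lia.
  have {1}-> : p = take (size p) peak by rewrite Ep take_size_cat.
  rewrite /peak take_cat size_nseq; case: (ltnP (size p) n) => [//|np].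
  by rewrite count_cat count_nseq /=; lia.
have -> : v = drop (size p) peak by rewrite Ep drop_size_cat.
by rewrite /peak drop_cat size_nseq pn !count_cat !count_nseq /=; lia.
Qed.
End NotMAC.

(** The path leaves [low peak], crosses the wall at [g] and arrives next to
    [up peak]; by [far_from_peak] the part before the crossing has length at
    least [2n] and the part after it at least [2n - 1]. *)
Lemma not_MAC_S2 (R : realType) : ~ MAC R S2.
Proof.
move=> [n [n_gt0 A]]; pose u := low (peak n); pose v := up (peak_tail n).
have [uE topE] := twist1 (twist_peak n).
have vtop : adj_vertices S2 v (up (peak n)).
  rewrite peakE // up_cat; apply/adj_mul/sym_gens2P.
  by exists x_letter; left.
have uv : dist S2 u v <= 2.
  have := dist_triangle generates_S2 u (up (peak n)) v.
  have := dist_adj (adj_top (twist_peak n)).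
  by have := dist_adj (adj_sym vtop); rewrite -/u; lia.
have n2 : n < (2 * n)%N by lia.
have [|||p [[u' [v' [[<-] [<-] pp inball]]] sp]] :=
  A (2 * n)%N n2 (Vertex R S2 u) (Vertex R S2 v).
- by rewrite /Sph /norm /= dist_peak.
- by rewrite /Sph /norm /= dist_peak_tail.
- by rewrite /= (ler_nat R _ 2).
have [f [f0 fp adj supp]] := edge_path_walk R pp.
have {inball} inball i : i <= size p -> dist S2 1 (f i) <= (2 * n)%N.
  by move=> /supp/inball; rewrite /cball /norm /= ler_nat.
have [|||l [g [_ lp fl fl1]]] := @walk_up _ f adj 0 (size p).
- by rewrite leq0n leqnn.
- by rewrite f0; exact: lower_low.
- by rewrite fp; exact: upper_up.
have gn : len g + `|height g|%N < (2 * n)%N.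
  have := leq_trans (norm2_le_dist _ _) (inball _ lp).
  rewrite invg1 mul1g fl1 /norm2 /= c_exp_letter t_exp_letter /= addr0; lia.
have far := far_from_peak n_gt0 gn.
have d1 : (2 * n)%N <= l.
  have := dist_walk generates_S2 adj (i := 0) (j := l); rewrite f0 fl leq0n.
  move=> /(_ (ltnW lp)); rewrite subn0 /u uE (dist_sym generates_S2) => ul.
  by apply: leq_trans ul; apply: leq_trans (parallel_le_dist _ _ _).
have d2 : (2 * n)%N <= (dist S2 (g, t_elt) v).+1.
  have := dist_triangle generates_S2 (g, t_elt) v (up (peak n)).
  have : (2 * n)%N <= dist S2 (g, t_elt) (up (peak n)).
    by rewrite topE; apply: leq_trans far (parallel_le_dist _ _ _).
  by have := dist_adj vtop; lia.
have d3 : dist S2 (g, t_elt) v <= size p - l.+1.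
  rewrite -fl1 -fp; apply: (dist_walk generates_S2 adj); lia.
lia.
Qed.

(** * Loop shortening fails for the slanted generating set *)

Lemma heights_nseq k (a : letter bool) :
  heights (nseq k a) = (k%:Z * (if a.2 then -1 else 1))%R.
Proof. by rewrite /heights exponent_nseq; case: (a.2); lia. Qed.

Lemma heights_cat (v w : word) : heights (v ++ w) = (heights v + heights w)%R.
Proof. exact: exponent_cat. Qed.

Lemma len_to_prefix g (w : word) k :
  len (g^-1 * fg_of w) <= len (g^-1 * fg_of (take k w)) + (size w - k).
Proof.
rewrite -{1}(cat_take_drop k w) fg_of_cat mulgA -size_drop.
by apply: leq_trans (lenM _ _) _; rewrite leq_add2l; exact: len_of.
Qed.

Lemma len_of_near g (w : word) : len g <= len (g^-1 * fg_of w) + size w.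
Proof.
rewrite -{1}(mulVKg (fg_of w) g) addnC; apply: leq_trans (lenM _ _) _.
apply: leq_add; first exact: len_of.
by rewrite -[g in leqLHS]invgK -invgM lenV.
Qed.

Section Zigzag.
Variable n : nat.

(** The exponent sum is zero at both ends and in the middle, but cutting off a
    prefix or a suffix [x^i] makes it negative, so what is saved in length by
    turning around early is lost again. *)
Definition zigzag : word :=
  nseq n x_letter ++ nseq n.*2 yV_letter ++ nseq n x_letter.

Lemma size_zigzag : size zigzag = (4 * n)%N.
Proof. by rewrite /zigzag !size_cat !size_nseq; lia. Qed.

Lemma zigzag_reduced : reduced zigzag.
Proof.
by do 2![apply: reduced_nseq_cat => //; last by case: n]; apply: reduced_nseq.
Qed.

Lemma twist_zigzag : fg_of (twist zigzag) = 1.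
Proof.
pose c : letter bool := (false, false).
have -> : twist zigzag =
    (word_inv (nseq n c) ++ nseq n c) ++ (nseq n c ++ word_inv (nseq n c)).
  by rewrite /twist !map_cat !map_nseq word_inv_nseq -addnn nseqD -!catA.
by rewrite fg_of_cat -[RHS]mulg1; congr (_ * _); apply: val_inj => /=;
  rewrite ?reduce_invl ?reduce_invr.
Qed.

Lemma take_zigzag i : i <= n -> take i zigzag = nseq i x_letter.
Proof. by move=> i_n; rewrite takel_cat ?size_nseq // take_nseq. Qed.

Lemma take_zigzag_end i : i <= n -> take (3 * n + i)%N zigzag =
  nseq n x_letter ++ nseq n.*2 yV_letter ++ nseq i x_letter.
Proof.
move=> i_n; rewrite /zigzag take_cat size_nseq ifN; last by lia.
rewrite take_cat size_nseq ifN; last by lia.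
by rewrite (_ : (3 * n + i - n - n.*2)%N = i) ?take_nseq //; lia.
Qed.

(** The middle block [y^(-2n)] survives in [g'^-1 g] when [g'] is close to the
    identity and [g] is close to the end of the zigzag. *)
Lemma long_between g g' : len g' < n -> len (g^-1 * fg_of zigzag) < n ->
  (4 * n)%N <= len (g'^-1 * g) + `|height (g'^-1 * g)|%N.
Proof.
move=> g'n gn; have [p [u [v [Eg Ez E]]]] := fg_mulVg_word g (fg_of zigzag : F2).
have [q [u' [v' [Eg' Eg2 E']]]] := fg_mulVg_word g' g.
have := count_sign_bound true (fg_word (g'^-1 * g)); apply: leq_trans.
rewrite -[4]/(2 * 2)%N -mulnA leq_mul2l [fg_word _]E' orFb.
move: Ez; rewrite /= reduced_reduce ?zigzag_reduced // => Ez.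
have pn : (3 * n <= size p)%N.
  have vn : size v < n by move: gn; rewrite /len E size_cat; lia.
  by have := size_zigzag; rewrite Ez size_cat; lia.
have gE : fg_word g =
    nseq n x_letter ++ nseq n.*2 yV_letter ++ (drop (3 * n)%N p ++ u).
  rewrite Eg -{1}(cat_take_drop (3 * n)%N p) -catA.
  have <- : take (3 * n)%N zigzag = take (3 * n)%N p by rewrite Ez takel_cat.
  by rewrite -{1}[(3 * n)%N]addn0 take_zigzag_end //= cats0 -catA.
have -> : v' = drop (size q) (fg_word g) by rewrite Eg2 drop_size_cat.
have qn : size q < n by move: g'n; rewrite /len Eg' size_cat; lia.
by rewrite gE drop_cat size_nseq qn !count_cat !count_nseq /=; lia.
Qed.

Lemma height_take_start i : i <= n -> heights (take i zigzag) = i.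
Proof. by move=> i_n; rewrite take_zigzag // heights_nseq /=; lia. Qed.

Lemma height_take_end i : i <= n ->
  heights (take (3 * n + i)%N zigzag) = (i%:Z - n%:Z)%R.
Proof.
by move=> i_n; rewrite take_zigzag_end // !heights_cat !heights_nseq /=; lia.
Qed.

(** The loop climbs from [low] to [up] at the identity, follows the zigzag along
    the upper side, descends at its end, and follows it backwards along the lower
    side; [position j] is the place reached on the zigzag at time [j]. *)
Definition position j : nat := if j <= (4 * n).+1 then j.-1 else (8 * n).+2 - j.

Definition strip j : F2xF2 :=
  if 0 < j <= (4 * n).+1 then up (take (position j) zigzag)
  else low (take (position j) zigzag).

Lemma strip_fst j : (strip j).1 = fg_of (take (position j) zigzag).
Proof. by rewrite /strip; case: ifP. Qed.

Lemma strip_upper j : upper (strip j) = (0 < j <= (4 * n).+1).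
Proof.
by rewrite /strip; case: ifP => _; [exact: upper_up | exact/negbTE/lower_low].
Qed.

Lemma strip_c_exp j :
  c_exp (strip j).2 = (- heights (take (position j) zigzag))%R.
Proof.
rewrite -c_exp_twist /strip; case: ifP => _ //=.
by rewrite /up -cat1s fg_of_cat c_expM c_exp_letter /= add0r.
Qed.

Lemma strip_loop : loop S2 (8 * n).+2 strip.
Proof.
have step i : i < (4 * n)%N ->
    exists a, take i.+1 zigzag = take i zigzag ++ [:: a].
  move=> i_n; exists (nth x_letter zigzag i).
  by rewrite (take_nth x_letter) ?size_zigzag // cats1.
have adj_slant z a : adj_vertices S2 z (z * gen_slant a).
  by apply/adj_mul/sym_gens2P; exists a; left.
have adj_low i : i < (4 * n)%N ->
    adj_vertices S2 (low (take i.+1 zigzag)) (low (take i zigzag)).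
  by move=> /step[a ->]; rewrite low_cat; apply/adj_sym/adj_slant.
have adj_up i : i < (4 * n)%N ->
    adj_vertices S2 (up (take i zigzag)) (up (take i.+1 zigzag)).
  by move=> /step[a ->]; rewrite up_cat; apply: adj_slant.
split.
  rewrite /strip /position ifN; last by lia.
  by rewrite ifN; [rewrite subnn | lia].
move=> [_|i]; first by rewrite /strip /position /= take0; apply: adj_top.
rewrite /strip /position ltnS => i_n; case: (ltngtP i (4 * n)%N) => i_4n.
- rewrite /= !ltnS (ltnW i_4n) i_4n; exact: adj_up.
- rewrite !ifN; [|lia..].
  have -> : ((8 * n).+2 - i.+1 = ((8 * n).+2 - i.+2).+1)%N by lia.
  by apply: adj_low; lia.
- rewrite i_4n /= !ltnS leqnn ltnn.
  rewrite (_ : (8 * n).+2 - (4 * n).+2 = 4 * n)%N; last by lia.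
  by rewrite -size_zigzag take_size; apply/adj_sym/adj_top/twist_zigzag.
Qed.

End Zigzag.

(** At the four times when the loop is at the extreme heights [n] and [-n], a
    nearby loop is on the same side of the wall as that loop.  Hence it crosses the wall
    between the second and the third of these times, and again between the fourth
    and, cyclically, the first.  A crossing has second coordinate [1] or [t], so
    it happens when the exponent of [c] along the loop is less than [K]; this
    puts the first crossing near the end of the zigzag and the second one near
    the identity, and [long_between] bounds both arcs between them. *)
Lemma not_LSP_S2 : ~ LSP S2.
Proof.
(* Crossing points are located up to [2K], and [long_between] needs them to be
   closer than [n] to the ends of the zigzag. *)
move=> [K LK]; pose n := (2 * K).+1; pose v := strip n.
have n0 : 1%N <= (8 * n).+2 by [].
have [m [u [mn [um adj] close1 close2]]] := LK _ v n0 (strip_loop n).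
have close j : j <= m -> dist S2 (u j) (v j) < K by apply: close1.
pose extreme j :=
  j = n.+1 \/ j = (3 * n).+1 \/ j = (5 * n).+2 \/ j = (7 * n).+2.
have c_exp_v j : extreme j ->
    `|c_exp (v j).2|%N = n.
  rewrite strip_c_exp /extreme => jj.
  have [E|E] : position n j = n \/ position n j = (3 * n + 0)%N.
    by rewrite /position; case: ifP; lia.
    by rewrite E height_take_start //; lia.
  by rewrite E height_take_end //; lia.
have side j : extreme j -> j <= m -> upper (u j) = upper (v j).
  move=> jj jm; have [//|ne] := eqVneq (upper (u j)) (upper (v j)).
  have := upper_dist ne.
  by rewrite c_exp_v //; have := close j jm; lia.
have c_end : c_exp (v (8 * n).+2).2 = 0%R.
  rewrite strip_c_exp /position ifN; last by lia.
  by rewrite subnn take0 /heights /exponent big_nil.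
(* A loop ending earlier would have its last point close to both the vertex at
   time [7n + 2] and the base point, which are at distance at least [n]. *)
have m_large : (7 * n).+2 <= m.
  rewrite leqNgt; apply/negP => m_lt.
  have := close2 (7 * n).+2; have := close2 (8 * n).+2.
  have := dist_triangle generates_S2 (v (7 * n).+2) (u m) (v (8 * n).+2).
  have := c_exp_le_dist (v (7 * n).+2) (v (8 * n).+2).
  rewrite c_end sub0r abszN c_exp_v; last by rewrite /extreme; lia.
  by rewrite (dist_sym generates_S2 _ (u m)); lia.
have up1 : upper (u n.+1) by rewrite side ?strip_upper // /extreme; lia.
have up2 : upper (u (3 * n).+1) by rewrite side ?strip_upper // /extreme; lia.
have low1 : ~~ upper (u (5 * n).+2) by rewrite side ?strip_upper // /extreme; lia.
have low2 : ~~ upper (u (7 * n).+2) by rewrite side ?strip_upper // /extreme; lia.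
have near g h j : u j = (g, h) -> c_exp h = 0%R -> j <= m ->
    (`|heights (take (position n j) (zigzag n))|%N < K /\
     len (g^-1 * fg_of (take (position n j) (zigzag n))) < K).
  move=> uj h0 jm; split.
    apply: leq_ltn_trans (close j jm); apply: leq_trans (c_exp_le_dist _ _).
    by rewrite uj strip_c_exp /= h0; lia.
  apply: leq_ltn_trans (close j jm); apply: leq_trans (len1_le_dist _ _).
  by rewrite uj strip_fst.
have c_tg : c_exp t_elt = 0%R by rewrite c_exp_letter.
have c_1 : c_exp 1 = 0%R by case: exponents_one => _ [].
have [|l [g [l_lo l_hi ul ul1]]] := walk_down adj _ up2 low1; first lia.
have g_end : len (g^-1 * fg_of (zigzag n)) < n.
  have [] := near _ _ _ ul c_tg; first lia.
  have [i i_n E] : exists2 i, i <= n & position n l = (3 * n + i)%N.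
    exists (position n l - 3 * n)%N; rewrite /position; case: ifP; lia.
  rewrite E height_take_end // => iK gK.
  by have := len_to_prefix g (zigzag n) (3 * n + i); rewrite size_zigzag; lia.
have start j g' h : u j = (g', h) -> c_exp h = 0%R -> j <= m ->
    (j <= n.+1) || ((7 * n).+2 <= j) -> len g' < n.
  move=> uj h0 jm j_range; have [] := near _ _ _ uj h0 jm.
  have i_n : position n j <= n by rewrite /position; case: ifP; lia.
  rewrite height_take_start // => iK gK.
  have := len_of_near g' (take (position n j) (zigzag n)).
  by rewrite size_take size_zigzag; case: ifP; lia.
have apart g' h : len g' < n -> (4 * n)%N <= dist S2 (g', h) (g, h).
  move=> g'n.
  exact: leq_trans (long_between g'n g_end) (parallel_le_dist _ _ _).
have walk := dist_walk generates_S2 adj.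
(* The base point of the loop [u] may be on either side of the wall, and the
   second crossing is before or after it accordingly. *)
have [l' [g' [ul' ul'1 g'n l'_range]]] : exists l' g',
    [/\ u l' = (g', 1), u l'.+1 = (g', t_elt), len g' < n &
        (l' < l) || ((7 * n).+2 <= l' < m)].
  have [u0|u0] := boolP (upper (u 0)).
    have [|||l' [g' [lo hi ul' ul'1]]] := @walk_up m u adj (7 * n).+2 m.
    - by rewrite m_large leqnn.
    - by [].
    - by rewrite um.
    by exists l', g'; split=> //; [apply: (start _ _ _ ul') | ]; lia.
  have [|l' [g' [lo hi ul' ul'1]]] := walk_up adj _ u0 up1; first lia.
  by exists l', g'; split=> //; [apply: (start _ _ _ ul') | ]; lia.
have A1 := apart g' 1 g'n; have A2 := apart g' t_elt g'n.
rewrite (dist_sym generates_S2) in A1.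
rewrite -ul'1 -ul in A2; rewrite -ul' -ul1 in A1.
case/orP: l'_range => l'_range.
  have := walk l'.+1 l; have := walk l.+1 m; have := walk 0 l'.
  have := dist_triangle generates_S2 (u l.+1) (u m) (u l').
  rewrite um; lia.
have := walk l.+1 l'; have := walk l'.+1 m; have := walk 0 l.
have := dist_triangle generates_S2 (u l'.+1) (u m) (u l).
rewrite um; lia.
Qed.

(** * Dependence on the generating set *)

Lemma depends_S1_S2 (K : pair_property) :
  K F2xF2 S1 -> ~ K F2xF2 S2 -> depends_on_generating_set K.
Proof.
move=> K1 nK2; exists F2xF2, S1, S2.
exact: And4 generates_S1 generates_S2 K1 nK2.
Qed.

Theorem mainTheorem3 (R : realType) :
  (generates S1 /\ generates S2) /\
  (* (i) *)
  (forall K : pair_property,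
     (forall (G : groupType) (S : {fset G}), generates S -> FFTP S -> K G S) ->
     (forall (G : groupType) (S : {fset G}), generates S -> K G S -> MAC R S) ->
     [/\ K F2xF2 S1, ~ K F2xF2 S2 & depends_on_generating_set K]) /\
  (depends_on_generating_set (@FFTP) /\
   depends_on_generating_set (@BLSP) /\
   depends_on_generating_set (@AlmostConvex R) /\
   depends_on_generating_set (@PoenaruP2 R) /\
   depends_on_generating_set (@MprimeAC R) /\
   depends_on_generating_set (@MAC R)) /\
  (* (ii) *)
  (LSP S1 /\ ~ LSP S2 /\ depends_on_generating_set (@LSP)).
Proof.
have BLSP1 := FFTP_BLSP generates_S1 FFTP_S1.
have LSP1 := BLSP_LSP BLSP1.
have nBLSP2 : ~ BLSP S2 := fun B => not_LSP_S2 (BLSP_LSP B).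
have nFFTP2 : ~ FFTP S2 := fun F => nBLSP2 (FFTP_BLSP generates_S2 F).
have AC1 := AC_S1 R; have P21 := AC_P2 AC1.
have M'AC1 := P2_MprimeAC P21; have MAC1 := MprimeAC_MAC M'AC1.
have nMAC2 := @not_MAC_S2 R.
have nM'AC2 : ~ MprimeAC R S2 := fun A => nMAC2 (MprimeAC_MAC A).
have nP22 : ~ PoenaruP2 R S2 := fun A => nM'AC2 (P2_MprimeAC A).
have nAC2 : ~ AlmostConvex R S2 := fun A => nP22 (AC_P2 A).
split; first exact: conj generates_S1 generates_S2.
split.
  move=> K FK KM; have K1 : K F2xF2 S1 := FK _ _ generates_S1 FFTP_S1.
  have nK2 : ~ K F2xF2 S2 by move=> /(KM _ _ generates_S2)/nMAC2.
  exact: And3 K1 nK2 (depends_S1_S2 K1 nK2).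
split; last first.
  exact: conj LSP1 (conj not_LSP_S2 (@depends_S1_S2 (@LSP) LSP1 not_LSP_S2)).
split; first exact: (@depends_S1_S2 (@FFTP) FFTP_S1 nFFTP2).
split; first exact: (@depends_S1_S2 (@BLSP) BLSP1 nBLSP2).
split; first exact: (@depends_S1_S2 (@AlmostConvex R) AC1 nAC2).
split; first exact: (@depends_S1_S2 (@PoenaruP2 R) P21 nP22).
split; first exact: (@depends_S1_S2 (@MprimeAC R) M'AC1 nM'AC2).
exact: (@depends_S1_S2 (@MAC R) MAC1 nMAC2).
Qed.
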